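(* Let $(\mathfrak{A},\Phi,\varphi)$ be a C*-dynamical system, with GNS representation $(\mathcal{H}_\varphi,\pi_\varphi,\Omega_\varphi)$ of $\varphi$ and associated contraction $\mathbf{U}_{\Phi,\varphi}$ on $\mathcal{H}_\varphi$. Then there exists a triple $(\mathcal{H}_\infty,\pi_\infty,\Omega_\infty)$ such that: ($\alpha$) $\mathcal{H}_\infty$ is a Hilbert space and there is a linear isometry $\mathbf{Z}_0:\mathcal{H}_\varphi\to\mathcal{H}_\infty$; ($\beta$) $\pi_\infty:\mathfrak{A}\to\mathcal{B}(\mathcal{H}_\infty)$ is a representation with $\pi_\infty(a)\mathbf{Z}_0=\mathbf{Z}_0\pi_\varphi(a)$ for all $a\in\mathfrak{A}$; ($\gamma$) $\Omega_\infty=\mathbf{Z}_0\Omega_\varphi$. Moreover, there exists a linear isometry $\mathbf{V}_\infty\in\mathcal{B}(\mathcal{H}_\infty)$ such that: (1) $\mathbf{V}_\infty$ is an isometric dilation of $\mathbf{U}_{\Phi,\varphi}^*$, i.e. $(\mathbf{U}_{\Phi,\varphi}^{*})^n=\mathbf{Z}_0^*\mathbf{V}_\infty^n\mathbf{Z}_0$ for all $n\in\mathbb{N}$, and $\mathbf{V}_\infty\Omega_\infty=\Omega_\infty$; (2) the vector $\Omega_\infty$ is cyclic for the *-subalgebra of $\mathcal{B}(\mathcal{H}_\infty)$ generated by $\bigcup_{n\ge 0}\{\mathbf{V}_\infty^n\pi_\infty(a)\mathbf{V}_\infty^{*n}:a\in\mathfrak{A}\}$; (3) for each $a\in\mathfrak{A}$,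 $\pi_\infty(\Phi(a))=\mathbf{V}_\infty^*\pi_\infty(a)\mathbf{V}_\infty$ and $\varphi(a)=\langle\Omega_\infty,\pi_\infty(a)\Omega_\infty\rangle$. The quadruple $(\pi_\infty,\mathcal{H}_\infty,\Omega_\infty,\mathbf{V}_\infty)$ is uniquely determined by properties (1)-(3) up to unitary equivalence: if $(\pi,\mathcal{H},\Omega,\mathbf{V})$ is another quadruple consisting of a representation $\pi$ of $\mathfrak{A}$ on a Hilbert space $\mathcal{H}$, a vector $\Omega\in\mathcal{H}$ and a linear isometry $\mathbf{V}$ on $\mathcal{H}$, which satisfies the analogues of (1)-(3) (with (1) holding for some linear isometry $\mathbf{Z}:\mathcal{H}_\varphi\to\mathcal{H}$ in place of $\mathbf{Z}_0$), then there is a unitary $\mathbf{W}:\mathcal{H}_\infty\to\mathcal{H}$ with $\mathbf{W}\pi_\infty(a)=\pi(a)\mathbf{W}$ for all $a\in\mathfrak{A}$, $\mathbf{W}\Omega_\infty=\Omega$ and $\mathbf{W}\mathbf{V}_\infty=\mathbf{V}\mathbf{W}$.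
   Context: A C*-dynamical system is a triple $(\mathfrak{A},\Phi,\varphi)$ consisting of a unital C*-algebra $\mathfrak{A}$, a unital completely positive map (ucp-map) $\Phi:\mathfrak{A}\to\mathfrak{A}$ and a state $\varphi$ on $\mathfrak{A}$ with $\varphi\circ\Phi=\varphi$. A representation of $\mathfrak{A}$ is a unital *-homomorphism into $\mathcal{B}(\mathcal{H})$. Inner products are linear in the second variable, and $\mathbb{N}=\{0,1,2,\dots\}$. $(\mathcal{H}_\varphi,\pi_\varphi,\Omega_\varphi)$ denotes the GNS representation of $\varphi$, and $\mathbf{U}_{\Phi,\varphi}$ is the unique linear contraction on $\mathcal{H}_\varphi$ with $\mathbf{U}_{\Phi,\varphi}\pi_\varphi(a)\Omega_\varphi=\pi_\varphi(\Phi(a))\Omega_\varphi$ for all $a\in\mathfrak{A}$. *)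

(* Defs.v *)
(* The complex numbers are R[i] for an arbitrary R : realType. *)
From HB Require Import structures.
From mathcomp Require Import all_boot all_order all_algebra.
From mathcomp Require Import complex.
From mathcomp Require Import all_classical all_reals all_analysis.

Set Implicit Arguments.
Unset Strict Implicit.
Unset Printing Implicit Defensive.

Import Order.TTheory GRing.Theory Num.Theory.
Import numFieldNormedType.Exports.

Local Open Scope classical_set_scope.
Local Open Scope ring_scope.
Local Open Scope complex_scope.

(* The norm of a normedModType over R[i] takes its values in R[i], where
   x <= y means that y - x is a nonnegative real. *)

HB.mixin Record CompleteNormedModule_isHilbert (R : realType) H
    & CompleteNormedModule R[i] H := {
  inner : H -> H -> R[i];
  inner_linearr : forall (x y z : H) (c : R[i]),
    inner x (c *: y + z) = c * inner x y + inner x z;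
  inner_conj : forall x y : H, inner y x = Num.conj (inner x y);
  inner_norm : forall x : H, inner x x = `|x| ^+ 2
}.

#[short(type="hilbertType")]
HB.structure Definition Hilbert (R : realType) :=
  {H of CompleteNormedModule R[i] H & CompleteNormedModule_isHilbert R H}.

(* The library has no normed algebras, and its hierarchy of structures does not
   allow joining algType with normedModType: the norm and its completeness are
   part of the mixin. The ring structure of an algType forces 1 != 0: a unital
   C*-algebra carrying a state is nonzero, so this excludes nothing here. *)
HB.mixin Record Algebra_isCstar (R : realType) A & GRing.Algebra R[i] A := {
  star : A -> A;
  starK : involutive star;
  star_antilinear : forall (c : R[i]) (a b : A),
    star (c *: a + b) = Num.conj c *: star a + star b;
  starM : forall a b : A, star (a * b) = star b * star a;
  cstar_norm : A -> R;
  cstar_norm0_eq0 : forall a : A, cstar_norm a = 0 -> a = 0;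
  cstar_normD : forall a b : A,
    cstar_norm (a + b) <= cstar_norm a + cstar_norm b;
  cstar_normZ : forall (c : R[i]) (a : A),
    (cstar_norm (c *: a))%:C = `|c| * (cstar_norm a)%:C;
  cstar_normM : forall a b : A,
    cstar_norm (a * b) <= cstar_norm a * cstar_norm b;
  cstar_identity : forall a : A, cstar_norm (star a * a) = cstar_norm a ^+ 2;
  cstar_complete : forall u : nat -> A,
    (forall e : R, 0 < e -> exists N : nat, forall m n : nat,
      (N <= m)%N -> (N <= n)%N -> cstar_norm (u m - u n) < e) ->
    exists l : A, cstar_norm (u n - l) @[n --> \oo] --> (0 : R)
}.

#[short(type="cstarAlgType")]
HB.structure Definition CstarAlgebra (R : realType) :=
  {A of GRing.Algebra R[i] A & Algebra_isCstar R A}.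

Section Systems.
Variables (R : realType) (A : cstarAlgType R).

(* B >= 0 in the C*-algebra M_n(A), whose involution is the conjugate
   transpose. *)
Definition positive_mx n (B : 'M[A]_n) : Prop :=
  exists D : 'M[A]_n, B = (map_mx star D)^T *m D.

Definition completely_positive (Phi : A -> A) : Prop :=
  forall n (B : 'M[A]_n), positive_mx B -> positive_mx (map_mx Phi B).

Definition ucp_map (Phi : {linear A -> A}) : Prop :=
  Phi 1 = 1 /\ completely_positive Phi.

Definition state (phi : {scalar A}) : Prop :=
  (forall a : A, 0 <= phi (star a * a)) /\ phi 1 = 1.

Definition cstar_dynamical_system (Phi : {linear A -> A}) (phi : {scalar A}) :
    Prop :=
  [/\ ucp_map Phi, state phi & forall a : A, phi (Phi a) = phi a].

End Systems.

Section Operators.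
Variables (R : realType) (H K : hilbertType R).

Definition bounded_operator (T : H -> K) : Prop :=
  linear T /\ exists M : R[i], forall x : H, `|T x| <= M * `|x|.

(* For a bounded operator T the set below is a singleton by the Riesz
   representation theorem; the default value 0 is then never used. *)
Definition adj (T : H -> K) (y : K) : H :=
  xget 0 [set z : H | forall x : H, inner z x = inner y (T x)].

Definition linear_isometry (T : H -> K) : Prop :=
  linear T /\ forall x : H, `|T x| = `|x|.

End Operators.

Definition unitary (R : realType) (H K : hilbertType R) (W : H -> K) : Prop :=
  [/\ bounded_operator W, adj W \o W =1 id & W \o adj W =1 id].

Section Representations.
Variables (R : realType) (A : cstarAlgType R) (H : hilbertType R).

Record representation (pi : A -> H -> H) : Prop := {
  repr_bounded : forall a : A, bounded_operator (pi a);
  repr_linear : forall (c : R[i]) (a b : A) (x : H),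
    pi (c *: a + b) x = c *: pi a x + pi b x;
  repr_mul : forall a b : A, pi (a * b) =1 pi a \o pi b;
  repr_one : pi 1 =1 id;
  repr_star : forall a : A, pi (star a) =1 adj (pi a)
}.

Record star_subalgebra (M : set (H -> H)) : Prop := {
  star_subalgebra_bounded : M `<=` @bounded_operator R H H;
  star_subalgebra0 : M (fun=> 0);
  star_subalgebraD : forall S T, M S -> M T -> M (fun x => S x + T x);
  star_subalgebraZ : forall (c : R[i]) T, M T -> M (fun x => c *: T x);
  star_subalgebraM : forall S T, M S -> M T -> M (S \o T);
  star_subalgebra_adj : forall T, M T -> M (adj T)
}.

Definition cyclic_vector (M : set (H -> H)) (Omega : H) : Prop :=
  dense [set T Omega | T in M].

Definition GNS_triple (phi : {scalar A}) (pi : A -> H -> H) (Omega : H) :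
    Prop :=
  [/\ representation pi,
      forall a : A, phi a = inner Omega (pi a Omega)
    & cyclic_vector (range pi) Omega].

(* When (pi, Omega) is a GNS triple of phi, Omega is cyclic, so at most one U
   satisfies this. *)
Definition GNS_contraction (Phi : A -> A) (pi : A -> H -> H) (Omega : H)
    (U : H -> H) : Prop :=
  [/\ linear U, forall x : H, `|U x| <= `|x|
    & forall a : A, U (pi a Omega) = pi (Phi a) Omega].

Definition translates (pi : A -> H -> H) (V : H -> H) : set (H -> H) :=
  [set T | exists (n : nat) (a : A),
    T = iter n V \o pi a \o iter n (adj V)].

End Representations.

(* (pi, Omega, V) on H dilates (Phi, phi), with V an isometric dilation of
   the adjoint of U along the embedding Z of the GNS space G. *)
Record isometric_dilation (R : realType) (A : cstarAlgType R)
    (Phi : {linear A -> A}) (phi : {scalar A})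
    (G : hilbertType R) (U : G -> G) (H : hilbertType R) (Z : G -> H)
    (pi : A -> H -> H) (Omega : H) (V : H -> H) : Prop := {
  dilation_pow : forall n : nat,
    iter n (adj U) =1 adj Z \o iter n V \o Z;
  dilation_fix : V Omega = Omega;
  dilation_cyclic :
    cyclic_vector (smallest (@star_subalgebra R H) (translates pi V)) Omega;
  dilation_map : forall a : A, pi (Phi a) =1 adj V \o pi a \o V;
  dilation_state : forall a : A, phi a = inner Omega (pi a Omega)
}.

(* Main.v *)
Require Import Defs.
From HB Require Import structures.
From mathcomp Require Import all_boot all_order all_algebra.
From mathcomp Require Import complex ring lra.
From mathcomp Require Import all_classical all_reals all_analysis.

Set Implicit Arguments.
Unset Strict Implicit.
Unset Printing Implicit Defensive.

Import Order.TTheory GRing.Theory Num.Theory.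
Import numFieldNormedType.Exports.

Local Open Scope classical_set_scope.
Local Open Scope ring_scope.
Local Open Scope complex_scope.

(** Read a finite sequence [:: a0; a1; ...; ak] of elements of the algebra as
    the vector

      pi a0 (V (pi a1 (V ... (pi ak (V Omega)))))

    of a dilation (pi, Omega, V); such a vector is called a word, and the empty
    word is Omega. Both halves of the theorem are statements about words.

    Uniqueness. Moving one letter of each word across an inner product gives

      < word (a :: s), pi c (word (b :: t)) >
        = < word s, pi (Phi (star a * c * b)) (word t) >,

    because adj V o pi x o V = pi (Phi x). Hence the inner products of words
    are the multi-time correlations of the dynamical system, expressions in Phi
    and phi alone (inner_word). The words are moreover total exactly when Omega
    is cyclic for the star-subalgebra generated by the translates. On the one
    hand the closed span of the words is invariant under all pi a, V and adj V
    (word_total). On the other hand that algebra is stable under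
    T |-> V o T o adj V, so a letter can be put in front of a word without
    leaving the orbit of Omega (total_word_cyclic). Two total families with the
    same Gram matrix differ by a unitary (gram_unitary), and this unitary
    intertwines all the data because V and pi a act on words by operations on
    sequences: V puts the letter 1 in front, pi a multiplies the first letter.

    Existence. Complete positivity of Phi, used once per letter, makes the
    correlation kernel positive definite (correlation_positive), so that it is
    the Gram matrix of a total family in some Hilbert space
    (Kolmogorov_decomposition). The two operations on sequences then define V
    and pi on this space. V is isometric because Phi 1 = 1; pi a is bounded
    because M - star a * a is of the form star y * y for large M
    (cstar_dominated), which comes from a square root in the C*-algebra.

    The GNS space embeds by Z (piphi a Omegaphi) = pi a Omega, and
    Z o U = adj V o Z holds on these vectors, hence everywhere. Iterating this
    identity and taking adjoints shows that V dilates adj U. *)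

(** * Real-valued norms and limits with an explicit rate *)

(** Norms over R[i] are valued in R[i]; their real parts can be compared by
    real arithmetic. *)
Definition rnorm (R : realType) (V : normedZmodType R[i]) (x : V) : R :=
  complex.Re `|x|.

Section RealNorm.
Variable R : realType.
Implicit Types (V : normedZmodType R[i]) (E : normedModType R[i]).

Lemma rnormE V (x : V) : `|x| = (rnorm x)%:C.
Proof.
rewrite /rnorm; have := normr_ge0 x; case: `|x| => a b /=.
by rewrite lecE /= => /andP[/eqP-> _].
Qed.

Lemma rnorm_ge0 V (x : V) : 0 <= rnorm x.
Proof. by rewrite -lecR -rnormE normr_ge0. Qed.
Local Hint Resolve rnorm_ge0 : core.

Lemma rnormD V (x y : V) : rnorm (x + y) <= rnorm x + rnorm y.
Proof. by rewrite -lecR rmorphD /= -!rnormE ler_normD. Qed.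

Lemma rnormN V (x : V) : rnorm (- x) = rnorm x.
Proof. by rewrite /rnorm normrN. Qed.

Lemma rdistC V (x y : V) : rnorm (x - y) = rnorm (y - x).
Proof. by rewrite /rnorm distrC. Qed.

Lemma rdistD V (z x y : V) : rnorm (x - y) <= rnorm (x - z) + rnorm (z - y).
Proof. by rewrite -lecR rmorphD /= -!rnormE ler_distD. Qed.

Lemma rnorm0 V : rnorm (0 : V) = 0.
Proof. by rewrite /rnorm normr0. Qed.

Lemma rnorm_eq0 V (x : V) : rnorm x = 0 -> x = 0.
Proof. by move=> h; apply/eqP; rewrite -normr_eq0 rnormE h. Qed.

Lemma rnormZ E (c : R[i]) (x : E) : rnorm (c *: x) = rnorm c * rnorm x.
Proof. by apply: complexI; rewrite rmorphM /= -!rnormE normrZ. Qed.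

Lemma rnormM (c d : R[i]) : rnorm (c * d) = rnorm c * rnorm d.
Proof. by apply: complexI; rewrite rmorphM /= -!rnormE normrM. Qed.

Lemma rnorm_conj (c : R[i]) : rnorm (Num.conj c) = rnorm c.
Proof. by rewrite /rnorm norm_conjC. Qed.

Lemma rnorm_real (r : R) : rnorm r%:C = `|r|.
Proof. by apply: complexI; rewrite -rnormE normc_def /= expr0n addr0 sqrtr_sqr. Qed.

Lemma conj_real (r : R) : Num.conj r%:C = r%:C :> R[i].
Proof. by apply/eqP; rewrite eq_complex /= oppr0 !eqxx. Qed.

Lemma rnorm_sqr (c : R[i]) : (rnorm c ^+ 2)%:C = c * Num.conj c.
Proof. by rewrite rmorphXn /= -rnormE normCK. Qed.

Lemma Re_le_rnorm (c : R[i]) : complex.Re c <= rnorm c.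
Proof.
rewrite /rnorm; case: c => a b; rewrite normc_def /=.
apply: le_trans (ler_norm a) _; rewrite -sqrtr_sqr ler_wsqrtr //.
by rewrite lerDl sqr_ge0.
Qed.

Lemma Im_le_rnorm (c : R[i]) : `|complex.Im c| <= rnorm c.
Proof.
rewrite /rnorm; case: c => a b; rewrite normc_def /=.
by rewrite -sqrtr_sqr ler_wsqrtr // lerDr sqr_ge0.
Qed.

Lemma normRe_le_rnorm (c : R[i]) : `|complex.Re c| <= rnorm c.
Proof.
rewrite /rnorm; case: c => a b; rewrite normc_def /=.
by rewrite -sqrtr_sqr ler_wsqrtr // lerDl sqr_ge0.
Qed.

Lemma rnorm_le (c : R[i]) : rnorm c <= `|complex.Re c| + `|complex.Im c|.
Proof.
rewrite /rnorm; case: c => a b; rewrite normc_def /=.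
rewrite -[leRHS](ger0_norm) ?addr_ge0 // -sqrtr_sqr ler_wsqrtr //.
have := real_normK (num_real a); have := real_normK (num_real b).
have := normr_ge0 a; have := normr_ge0 b; nra.
Qed.

(** The discriminant inequality behind Cauchy-Schwarz: a, b and c stand for
    the values of a positive semidefinite form at (x, x), (x, y) and (y, y),
    and the hypothesis is its positivity at x + t y. Only the t proportional to
    the conjugate of b matter, which leaves a real quadratic polynomial. *)
Lemma quadratic_bound (a c : R) (b : R[i]) : 0 <= c ->
  (forall t : R[i], 0 <= a + complex.Re (t * b) *+ 2 + rnorm t ^+ 2 * c) ->
  rnorm b ^+ 2 <= a * c.
Proof.
move=> c0 h.
have {}h (t : R) : 0 <= a + t * rnorm b ^+ 2 *+ 2 + t ^+ 2 * rnorm b ^+ 2 * c.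
  have := h (t%:C * Num.conj b).
  rewrite rnormM rnorm_real rnorm_conj exprMn real_normK ?num_real //.
  by rewrite -mulrA [Num.conj b * b]mulrC -rnorm_sqr -rmorphM /=.
move: (rnorm b ^+ 2) (sqr_ge0 (rnorm b)) h => B B0 h.
have [c_eq|cn0] := eqVneq c 0.
  rewrite c_eq mulr0; rewrite leNgt; apply/negP => Bp.
  have := h (- ((a + 1) / B)); rewrite c_eq mulr0 addr0 mulNr mulfVK ?gt_eqF //.
  have := h 0; rewrite mul0r mul0rn expr0n !mul0r !addr0 => a0.
  rewrite mulr2n; lra.
have cp : 0 < c by rewrite lt_def cn0.
have := h (- c^-1); rewrite sqrrN.
suff -> : a + - c^-1 * B *+ 2 + c^-1 ^+ 2 * B * c = (a * c - B) / c.
  by rewrite pmulr_lge0 ?invr_gt0 // subr_ge0.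
by field.
Qed.

Lemma harmonic_lt (e : R) : 0 < e -> exists n : nat, n.+1%:R^-1 < e.
Proof.
move=> e0; exists (Num.truncn e^-1).
rewrite invf_plt ?posrE ?ltr0n //.
by rewrite truncnS_gt.
Qed.

Lemma invS_gt0 n : (0 : R) < n.+1%:R^-1.
Proof. by rewrite invr_gt0 ltr0n. Qed.

Lemma harmonic_scaled_lt (c e : R) : 0 <= c -> 0 < e ->
  exists n : nat, c * n.+1%:R^-1 < e.
Proof.
move=> c0 e0; have [n hn] := harmonic_lt (divr_gt0 e0 (ltr_wpDl c0 ltr01)).
exists n; have := invS_gt0 n; move: (n.+1%:R^-1) hn => t.
by rewrite ltr_pdivlMr ?ltr_wpDl // => t1 t0; lra.
Qed.

(** All limits below are taken with errors of the form c / (n + 1), and this is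
    how an inequality passes to such a limit. *)
Lemma le_harmonic (a b c : R) : 0 <= c ->
  (forall n, a <= b + c * n.+1%:R^-1) -> a <= b.
Proof.
move=> c0 h; apply/ler_addgt0Pr => e /(harmonic_scaled_lt c0)[n hn].
by apply: le_trans (h n) _; rewrite lerD2l ltW.
Qed.

Lemma rnorm_harmonic V (x : V) (c : R) : 0 <= c ->
  (forall n, rnorm x <= c * n.+1%:R^-1) -> x = 0.
Proof.
move=> c0 h; apply: rnorm_eq0; apply/eqP; rewrite eq_le rnorm_ge0 andbT.
by apply: (le_harmonic c0) => n; rewrite add0r h.
Qed.

(** Every u n - c / (n + 1) is at most every u m + c / (m + 1), so the supremum
    of the former is squeezed between them. *)
Lemma real_limit (u : nat -> R) (c : R) :
  (forall m n, `|u m - u n| <= c * (m.+1%:R^-1 + n.+1%:R^-1)) ->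
  exists l, forall n, `|u n - l| <= c * n.+1%:R^-1.
Proof.
move=> h.
pose S := range (fun n => u n - c * n.+1%:R^-1).
have ub m : ubound S (u m + c * m.+1%:R^-1).
  move=> _ [n _ <-]; have := h n m; rewrite mulrDr.
  move/(le_trans (ler_norm _)).
  by move: (c * n.+1%:R^-1) (c * m.+1%:R^-1) => p q; lra.
have S0 : S !=set0 by exists (u 0%N - c * 1%:R^-1), 0%N.
exists (sup S) => n; rewrite ler_distl; apply/andP; split.
  by rewrite lerBlDr ge_sup.
rewrite -lerBlDr.
by apply: ub_le_sup; [exists (u 0%N + c * 1%:R^-1); exact: ub|exists n].
Qed.

Lemma complex_limit (u : nat -> R[i]) (c : R) :
  (forall m n, rnorm (u m - u n) <= c * (m.+1%:R^-1 + n.+1%:R^-1)) ->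
  exists l, forall n, rnorm (u n - l) <= c *+ 2 * n.+1%:R^-1.
Proof.
move=> h.
have [|a ha] := @real_limit (fun n => complex.Re (u n)) c.
  move=> m n; apply: le_trans (h m n); apply: le_trans (normRe_le_rnorm _).
  by case: (u m) (u n) => [? ?] [? ?].
have [|b hb] := @real_limit (fun n => complex.Im (u n)) c.
  move=> m n; apply: le_trans (h m n); apply: le_trans (Im_le_rnorm _).
  by case: (u m) (u n) => [? ?] [? ?].
exists (a +i* b) => n; apply: le_trans (rnorm_le _) _.
have := ha n; have := hb n; case: (u n) => x y /= h1 h2.
by rewrite mulr2n mulrDl lerD.
Qed.

End RealNorm.
#[global] Hint Extern 0 (is_true (0 <= _)) => solve [apply: rnorm_ge0] : core.

(** * Geometry of Hilbert spaces *)
Lemma ball_rnorm (R : realType) (V : normedModType R[i]) (x y : V) (e : R) :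
  ball x e%:C y <-> rnorm (x - y) < e.
Proof. by rewrite -ball_normE /= rnormE ltcR. Qed.

Section InnerProduct.
Variables (R : realType) (H : hilbertType R).
Implicit Types (x y z : H) (c : R[i]).

Lemma innerDr x y z : inner x (y + z) = inner x y + inner x z.
Proof. by rewrite -{1}[y]scale1r inner_linearr mul1r. Qed.

Lemma inner0r x : inner x 0 = 0.
Proof. by apply: (addrI (inner x 0)); rewrite -innerDr !addr0. Qed.

Lemma innerZr x c y : inner x (c *: y) = c * inner x y.
Proof. by rewrite -[c *: y]addr0 inner_linearr inner0r addr0. Qed.

Lemma innerNr x y : inner x (- y) = - inner x y.
Proof. by rewrite -scaleN1r innerZr mulN1r. Qed.

Lemma innerBr x y z : inner x (y - z) = inner x y - inner x z.
Proof. by rewrite innerDr innerNr. Qed.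

Lemma innerDl x y z : inner (y + z) x = inner y x + inner z x.
Proof. by rewrite inner_conj innerDr rmorphD /= -!inner_conj. Qed.

Lemma innerZl x c y : inner (c *: y) x = Num.conj c * inner y x.
Proof. by rewrite inner_conj innerZr rmorphM /= -inner_conj. Qed.

Lemma innerNl x y : inner (- y) x = - inner y x.
Proof. by rewrite inner_conj innerNr rmorphN /= -inner_conj. Qed.

Lemma innerBl x y z : inner (y - z) x = inner y x - inner z x.
Proof. by rewrite innerDl innerNl. Qed.

Lemma inner_self x : inner x x = (rnorm x ^+ 2)%:C.
Proof. by rewrite inner_norm rnormE rmorphXn. Qed.

Lemma rnorm_sqrD x y :
  rnorm (x + y) ^+ 2 =
  rnorm x ^+ 2 + complex.Re (inner x y) *+ 2 + rnorm y ^+ 2.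
Proof.
have : (rnorm (x + y) ^+ 2)%:C =
  (rnorm x ^+ 2)%:C + (inner x y + Num.conj (inner x y)) + (rnorm y ^+ 2)%:C.
  by rewrite -!inner_self -inner_conj innerDr !innerDl; ring.
move/(congr1 (@complex.Re R)); rewrite !raddfD /= => ->; congr (_ + _ + _).
by case: (inner x y) => a b; rewrite mulr2n.
Qed.

Lemma parallelogram x y :
  rnorm (x + y) ^+ 2 + rnorm (x - y) ^+ 2 =
  rnorm x ^+ 2 *+ 2 + rnorm y ^+ 2 *+ 2.
Proof. by rewrite !rnorm_sqrD innerNr rnormN raddfN /=; ring. Qed.

Lemma Cauchy_Schwarz x y : rnorm (inner x y) <= rnorm x * rnorm y.
Proof.
rewrite -(@ler_pXn2r _ 2) // ?nnegrE ?mulr_ge0 // exprMn.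
apply: quadratic_bound.
  exact: sqr_ge0.
move=> t; rewrite -exprMn -rnormZ -innerZr -rnorm_sqrD; exact: sqr_ge0.
Qed.

Lemma inner_inj x y : (forall z, inner x z = inner y z) -> x = y.
Proof.
move=> h; apply/eqP; rewrite -subr_eq0; apply/eqP/rnorm_eq0.
have := inner_self (x - y); rewrite {1}innerBl h subrr => /complexI/esym/eqP.
by rewrite sqrf_eq0 => /eqP.
Qed.

Lemma hilbert_limit (u : nat -> H) (c : R) : 0 <= c ->
  (forall m n, rnorm (u m - u n) <= c * (m.+1%:R^-1 + n.+1%:R^-1)) ->
  exists l, forall n, rnorm (u n - l) <= c * n.+1%:R^-1.
Proof.
move=> c0 h.
have anti m n : (n <= m)%N -> c * m.+1%:R^-1 <= c * n.+1%:R^-1.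
  by move=> nm; rewrite ler_wpM2l // lef_pV2 ?posrE ?ltr0n // ler_nat ltnS.
have cu : cauchy (u @ \oo).
  apply: cauchy_exP => e e0.
  have eE : e = (rnorm e)%:C by rewrite -rnormE gtr0_norm.
  have re0 : 0 < rnorm e by rewrite -ltcR -eE.
  have [n hn] := harmonic_scaled_lt c0 (divr_gt0 re0 (ltr0n R 2)).
  exists (u n); exists n => // m /= nm.
  rewrite -ball_normE /= eE rnormE ltcR.
  apply: le_lt_trans (h _ _) _; rewrite mulrDr.
  have := anti _ _ nm; move: hn; move: (c * _) (c * _) => p q; lra.
have /cvg_ex[l /cvgrPdist_le hl] : cvg (u @ \oo) by exact: cauchy_cvg.
exists l => n; apply: (@le_harmonic _ _ _ (c + 1)); first exact: addr_ge0.
move=> m; have [|k _ hk] := hl (m.+1%:R^-1)%:C.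
  by rewrite ltcR invS_gt0.
have := hk (maxn k m) (leq_maxl _ _); rewrite rnormE lecR rdistC => ub.
have := anti _ _ (leq_maxr k m); have := h n (maxn k m).
have := rdistD (u (maxn k m)) (u n) l; rewrite mulrDr mulrDl mul1r.
move: ub; move: (_^-1) (c * _) (c * _) (c * _) => p q r s; lra.
Qed.

End InnerProduct.

(** * The Riesz representation theorem *)
Section Riesz.
Variables (R : realType) (H : hilbertType R).

(** The representing vector is the minimizer of J x = |x|^2 - 2 Re (f x). The
    parallelogram identity makes a minimizing sequence Cauchy, and minimality up
    to an error e in all directions y forces |<x, y> - f y|^2 <= e |y|^2 by the
    discriminant inequality. *)
Lemma Riesz_representation (f : H -> R[i]) (M : R) :
  (forall c x y, f (c *: x + y) = c * f x + f y) ->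
  (forall x, rnorm (f x) <= M * rnorm x) ->
  exists z, forall x, inner z x = f x.
Proof.
move=> flin fM.
pose J x := rnorm x ^+ 2 - complex.Re (f x) *+ 2.
have Jlb x : - M ^+ 2 <= J x.
  have := le_trans (Re_le_rnorm _) (fM x); rewrite /J mulr2n.
  by move: (complex.Re (f x)) (rnorm x) => p q; have := sqr_ge0 (q - M); nra.
have JS : has_inf (range J).
  by split; [exists (J 0), 0|exists (- M ^+ 2) => _ [x _ <-]].
pose m := inf (range J).
have mJ x : m <= J x by apply: ge_inf; [case: JS|exists x].
have /choice[u hu] n : exists x, J x <= m + n.+1%:R^-1 ^+ 2.
  have [_ [x _ <-] /ltW] := inf_adherent (exprn_gt0 2 (@invS_gt0 R n)) JS.
  by exists x.
have f0 : f 0 = 0.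
  by apply: (addrI (f 0)); have := flin 1 0 0; rewrite scaler0 !addr0 mul1r.
have fZ c x : f (c *: x) = c * f x by rewrite -[c *: x]addr0 flin f0 addr0.
have fD x y : f (x + y) = f x + f y by rewrite -{1}[x]scale1r flin mul1r.
(* The linear terms cancel, which leaves the parallelogram identity. *)
have midpoint x y :
    rnorm (x - y) ^+ 2 = J x *+ 2 + J y *+ 2 - J (2%:R^-1 *: (x + y)) *+ 4.
  have -> : 2%:R^-1 = (2^-1)%:C :> R[i] by rewrite rmorphV ?unitfE// rmorphMn.
  rewrite /J rnormZ rnorm_real fZ fD ger0_norm ?invr_ge0 ?ler0n //.
  have -> : complex.Re ((2^-1)%:C * (f x + f y)) =
            2^-1 * (complex.Re (f x) + complex.Re (f y)).
    by case: (f x) (f y) => [a b] [c d] /=; rewrite mul0r subr0.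
  rewrite exprMn; have := parallelogram x y; move: (complex.Re _) (complex.Re _).
  by move: (rnorm (x + y) ^+ 2) (rnorm (x - y) ^+ 2) => p q a b; lra.
have [|m1 n1|z hz] := @hilbert_limit _ _ u 2.
- by [].
- have := hu m1; have := hu n1; have := mJ (2%:R^-1 *: (u m1 + u n1)).
  move: (@invS_gt0 R m1) (@invS_gt0 R n1) (midpoint (u m1) (u n1)).
  move: (m1.+1%:R^-1) (n1.+1%:R^-1) => p q p0 q0 e h1 h2 h3.
  rewrite -(@ler_pXn2r _ 2) // ?nnegrE ?mulr_ge0 ?addr_ge0 ?(ltW p0) ?(ltW q0) //.
  rewrite e; move: (mulr_gt0 p0 q0) (sqr_ge0 p) (sqr_ge0 q) h1 h2 h3; clear.
  by move: (J _) (J _) (J _) => a b c; nra.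
exists z => y; apply/eqP; rewrite -subr_eq0; apply/eqP.
apply: (@rnorm_harmonic _ _ _ (rnorm y *+ 3)); first by rewrite mulrn_wge0.
move=> n; have almost : rnorm (inner (u n) y - f y) <= n.+1%:R^-1 * rnorm y.
  rewrite -(@ler_pXn2r _ 2) // ?nnegrE ?mulr_ge0 ?(ltW (@invS_gt0 _ _)) //.
  rewrite exprMn; apply: quadratic_bound; first exact: sqr_ge0.
  move=> t; have := mJ (u n + t *: y); have := hu n; rewrite /J.
  rewrite rnorm_sqrD innerZr rnormZ exprMn fD fZ.
  rewrite mulrBr !raddfD !raddfN /=.
  move: (complex.Re _) (complex.Re _) (complex.Re _) (_ ^+ 2 * _).
  by move=> p q r s; move: (_ ^+ 2) (_ ^+ 2) => v w; lra.
apply: le_trans (rdistD (inner (u n) y) _ _) _; rewrite -innerBl.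
have close : rnorm (z - u n) * rnorm y <= 2 * n.+1%:R^-1 * rnorm y.
  by rewrite ler_wpM2r // rdistC.
apply: le_trans (lerD (le_trans (Cauchy_Schwarz _ _) close) almost) _.
by move: (n.+1%:R^-1) (rnorm y) => p q; lra.
Qed.

End Riesz.

(** * Bounded operators and their adjoints *)
Section Operators.
Variables (R : realType).
Implicit Types (H K L : hilbertType R).

Lemma boundedP H K (T : H -> K) :
  bounded_operator T <->
  linear T /\ exists2 M : R, 0 <= M & forall x, rnorm (T x) <= M * rnorm x.
Proof.
split=> -[Tlin [M]].
  move=> hM; split=> //; exists (rnorm M) => // x.
  rewrite -lecR rmorphM /= -!rnormE; apply: le_trans (_ : `|M * `|x| | <= _).
    by rewrite ger0_norm ?hM // (le_trans _ (hM x)).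
  by rewrite normrM normr_id.
move=> M0 hM; split=> //; exists M%:C => x.
by rewrite !rnormE -rmorphM lecR.
Qed.

Section Linear.
Variables (H K : hilbertType R) (T : H -> K).
Hypothesis Tlin : linear T.

Lemma linD x y : T (x + y) = T x + T y.
Proof. by rewrite -{1}[x]scale1r Tlin scale1r. Qed.

Lemma lin0 : T 0 = 0.
Proof. by apply: (addrI (T 0)); rewrite -linD !addr0. Qed.

Lemma linZ c x : T (c *: x) = c *: T x.
Proof. by rewrite -[c *: x]addr0 Tlin lin0 addr0. Qed.

Lemma linB x y : T (x - y) = T x - T y.
Proof. by rewrite -scaleN1r linD linZ scaleN1r. Qed.

End Linear.

Lemma bounded_linear H K (T : H -> K) : bounded_operator T -> linear T.
Proof. by case. Qed.

Lemma bounded_comp H K L (S : K -> L) (T : H -> K) :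
  bounded_operator S -> bounded_operator T -> bounded_operator (S \o T).
Proof.
move=> /boundedP[Sl [M M0 hM]] /boundedP[Tl [N N0 hN]]; apply/boundedP; split.
  by move=> c x y /=; rewrite Tl Sl.
exists (M * N); rewrite ?mulr_ge0 // => x /=; apply: le_trans (hM _) _.
by rewrite -mulrA ler_wpM2l.
Qed.

Lemma bounded_id H : bounded_operator (id : H -> H).
Proof. by split=> //; exists 1 => x; rewrite mul1r. Qed.

Lemma bounded_iter H (T : H -> H) n :
  bounded_operator T -> bounded_operator (iter n T).
Proof.
by move=> hT; elim: n => [|n IH]; [exact: bounded_id|exact: bounded_comp IH].
Qed.

Lemma bounded0 H K : bounded_operator (fun _ : H => 0 : K).
Proof.
split; first by move=> c x y /=; rewrite scaler0 addr0.
by exists 0 => x; rewrite normr0 mul0r.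
Qed.

Lemma boundedD H K (S T : H -> K) :
  bounded_operator S -> bounded_operator T ->
  bounded_operator (fun x => S x + T x).
Proof.
move=> /boundedP[Sl [M M0 hM]] /boundedP[Tl [N N0 hN]]; apply/boundedP; split.
  by move=> c x y /=; rewrite Sl Tl scalerDr addrACA.
exists (M + N); rewrite ?addr_ge0 // => x; apply: le_trans (rnormD _ _) _.
by rewrite mulrDl lerD.
Qed.

Lemma boundedZ H K (c : R[i]) (T : H -> K) :
  bounded_operator T -> bounded_operator (fun x => c *: T x).
Proof.
move=> /boundedP[Tl [M M0 hM]]; apply/boundedP; split.
  by move=> d x y /=; rewrite Tl scalerDr !scalerA mulrC.
exists (rnorm c * M); rewrite ?mulr_ge0 // => x.
by rewrite rnormZ -mulrA ler_wpM2l.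
Qed.

Section Adjoint.
Variables (H K : hilbertType R) (T : H -> K).
Hypothesis Tb : bounded_operator T.

Lemma adjP x y : inner (adj T y) x = inner y (T x).
Proof.
case/boundedP: Tb => Tl [M M0 hM].
have [||z hz] := @Riesz_representation _ H (fun x => inner y (T x)) (rnorm y * M).
- by move=> c u v; rewrite Tl inner_linearr.
- move=> u; apply: le_trans (Cauchy_Schwarz _ _) _.
  by rewrite -mulrA ler_wpM2l.
by apply: (@xgetPex _ 0 [set z | forall x, inner z x = inner y (T x)]); exists z.
Qed.

Lemma adjPr x y : inner x (adj T y) = inner (T x) y.
Proof. by rewrite inner_conj adjP -inner_conj. Qed.

Lemma adj_unique y z : (forall x, inner z x = inner y (T x)) -> adj T y = z.
Proof. by move=> hz; apply: inner_inj => x; rewrite adjP hz. Qed.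

Lemma bounded_adj : bounded_operator (adj T).
Proof.
case/boundedP: (Tb) => Tl [M M0 hM]; apply/boundedP; split.
  move=> c x y; apply: adj_unique => v.
  by rewrite !innerDl !innerZl !adjP.
exists M => // y; have [->|n0] := eqVneq (adj T y) 0.
  by rewrite rnorm0 mulr_ge0.
have p0 : 0 < rnorm (adj T y).
  rewrite lt_def rnorm_ge0 andbT; apply/eqP => /rnorm_eq0 y0.
  by rewrite y0 eqxx in n0.
rewrite -(ler_pM2l p0).
have -> : rnorm (adj T y) * rnorm (adj T y) = rnorm (inner y (T (adj T y))).
  by rewrite -adjP inner_self rnorm_real ger0_norm ?sqr_ge0 // expr2.
apply: le_trans (Cauchy_Schwarz _ _) _.
by rewrite [leRHS]mulrCA [leRHS]mulrA [leRHS]mulrC ler_wpM2l.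
Qed.

End Adjoint.

Lemma adjK H K (T : H -> K) : bounded_operator T -> adj (adj T) = T.
Proof.
move=> Tb; apply/funext => x; apply: adj_unique; first exact: bounded_adj.
by move=> y; rewrite adjPr.
Qed.

Lemma adj_comp H K L (S : K -> L) (T : H -> K) :
  bounded_operator S -> bounded_operator T -> adj (S \o T) = adj T \o adj S.
Proof.
move=> Sb Tb; apply/funext => x; apply: adj_unique; first exact: bounded_comp.
by move=> y /=; rewrite !adjP.
Qed.

Lemma adj_id H : adj (id : H -> H) = id.
Proof. by apply/funext => x; apply: adj_unique => //; exact: bounded_id. Qed.

Lemma iterC T (f : T -> T) n : f \o iter n f = iter n f \o f.
Proof. by apply/funext => x /=; rewrite -iterS iterSr. Qed.

Lemma adj_iter H (T : H -> H) n :
  bounded_operator T -> adj (iter n T) = iter n (adj T).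
Proof.
move=> Tb; elim: n => [|n IH]; first exact: adj_id.
have -> : iter n.+1 T = T \o iter n T by [].
rewrite adj_comp ?IH //; last exact: bounded_iter.
by rewrite -iterC.
Qed.

Lemma adj_zero H K : adj (fun _ : H => 0 : K) = fun=> 0.
Proof.
apply/funext => x; apply: adj_unique; first exact: bounded0.
by move=> y; rewrite inner0r inner_conj inner0r rmorph0.
Qed.

Lemma adj_add H K (S T : H -> K) : bounded_operator S -> bounded_operator T ->
  adj (fun x => S x + T x) = fun x => adj S x + adj T x.
Proof.
move=> Sb Tb; apply/funext => x; apply: adj_unique; first exact: boundedD.
by move=> y; rewrite innerDl innerDr !adjP.
Qed.

Lemma adj_scale H K (c : R[i]) (T : H -> K) : bounded_operator T ->
  adj (fun x => c *: T x) = fun x => Num.conj c *: adj T x.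
Proof.
move=> Tb; apply/funext => x; apply: adj_unique; first exact: boundedZ.
by move=> y; rewrite innerZl innerZr conjCK adjP.
Qed.

Lemma isometry_bounded H K (T : H -> K) :
  linear_isometry T -> bounded_operator T.
Proof. by move=> [Tl hT]; split=> //; exists 1 => x; rewrite mul1r hT. Qed.

Lemma isometry_rnorm H K (T : H -> K) x :
  linear_isometry T -> rnorm (T x) = rnorm x.
Proof. by move=> [_ hT]; rewrite /rnorm hT. Qed.

(** Norms determine the real part of the inner product, and the imaginary part
    is a real part after multiplying one argument by 'i. *)
Lemma isometry_inner H K (T : H -> K) x y :
  linear_isometry T -> inner (T x) (T y) = inner x y.
Proof.
move=> Ti; have [Tl _] := Ti.
have ReT u v : complex.Re (inner (T u) (T v)) = complex.Re (inner u v).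
  have := rnorm_sqrD (T u) (T v).
  rewrite -(linD Tl) !(isometry_rnorm _ Ti) rnorm_sqrD.
  by rewrite !mulr2n; lra.
have := ReT x ('i *: y); have := ReT x y; rewrite (linZ Tl) !innerZr.
case: (inner _ _) (inner _ _) => [a b] [c d] /= -> h.
by congr (_ +i* _); move: h; rewrite !mul0r !mul1r; lra.
Qed.

Lemma isometry_adjK H K (T : H -> K) x : linear_isometry T -> adj T (T x) = x.
Proof.
move=> Ti; apply: adj_unique; first exact: isometry_bounded.
by move=> y; rewrite isometry_inner.
Qed.

End Operators.

(** * Total families and the operators they determine *)
Section LinearCombinations.
Variables (K : pzRingType) (X : Type).
Implicit Types (E : lmodType K) (l : seq (K * X)).

Definition lincomb E (f : X -> E) l : E := \sum_(p <- l) p.1 *: f p.2.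

Definition scale_comb (c : K) l := [seq (c * p.1, p.2) | p <- l].

Lemma lincomb_cat E (f : X -> E) l l' :
  lincomb f (l ++ l') = lincomb f l + lincomb f l'.
Proof. exact: big_cat. Qed.

Lemma lincomb_scale E (f : X -> E) c l :
  lincomb f (scale_comb c l) = c *: lincomb f l.
Proof.
by rewrite /lincomb big_map scaler_sumr; apply: eq_bigr => p _; rewrite scalerA.
Qed.

Lemma lincomb1 E (f : X -> E) x : lincomb f [:: (1, x)] = f x.
Proof. by rewrite /lincomb big_seq1 scale1r. Qed.

End LinearCombinations.

Section Totality.
Variables (R : realType).
Implicit Types (H K : hilbertType R).

Lemma lin_lincomb X H K (T : H -> K) (f : X -> H) l :
  linear T -> T (lincomb f l) = lincomb (T \o f) l.
Proof.
move=> Tl; elim: l => [|p l IH]; first by rewrite /lincomb !big_nil lin0.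
by rewrite /lincomb !big_cons Tl; congr (_ + _).
Qed.

Lemma inner_lincomb X H (f g : X -> H) l l' :
  inner (lincomb f l) (lincomb g l') =
  \sum_(p <- l) \sum_(q <- l') Num.conj p.1 * q.1 * inner (f p.2) (g q.2).
Proof.
elim: l => [|p l IH]; first by rewrite /lincomb !big_nil inner_conj inner0r rmorph0.
rewrite /lincomb !big_cons innerDl innerZl -IH; congr (_ + _).
elim: l' {IH} => [|q l' IH']; first by rewrite !big_nil inner0r mulr0.
by rewrite !big_cons innerDr innerZr mulrDr mulrA IH'.
Qed.

Definition total_family X H (f : X -> H) :=
  forall x (e : R), 0 < e -> exists l, rnorm (x - lincomb f l) < e.

Lemma denseP H (S : set H) :
  dense S <-> forall x (e : R), 0 < e -> exists2 s, S s & rnorm (x - s) < e.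
Proof.
split=> [dS x e e0|hS O [x Ox] Oo].
  have [||y [/= xy Sy]] := dS (ball x e%:C)°.
  - exists x; apply: nbhsx_ballx; by rewrite ltcR.
  - exact: open_interior.
  exists y => //; move/interior_subset: xy.
  by rewrite -ball_normE /= rnormE ltcR.
have /nbhs_ballP[e /= e0 he] : nbhs x O by exact: open_nbhs_nbhs.
have eE : e = (rnorm e)%:C by rewrite -rnormE gtr0_norm.
have [|s Ss xs] := hS x (rnorm e); first by rewrite -ltcR -eE.
by exists s; split=> //; apply: he; rewrite -ball_normE /= eE rnormE ltcR.
Qed.

Lemma total_bounded_eq X H K (f : X -> H) (S T : H -> K) :
  total_family f -> bounded_operator S -> bounded_operator T ->
  (forall i, S (f i) = T (f i)) -> S =1 T.
Proof.
move=> ft /boundedP[Sl [M M0 hM]] /boundedP[Tl [N N0 hN]] ST x.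
apply/eqP; rewrite -subr_eq0; apply/eqP.
apply: (@rnorm_harmonic _ _ _ (M + N)); first exact: addr_ge0.
move=> n; have [l xl] := ft x _ (@invS_gt0 R n).
have <- : S (x - lincomb f l) - T (x - lincomb f l) = S x - T x.
  have -> : x - lincomb f l = x + lincomb f (scale_comb (-1) l).
    by rewrite lincomb_scale scaleN1r.
  rewrite (linD Sl) (linD Tl) opprD addrACA.
  rewrite (lin_lincomb _ _ Sl) (lin_lincomb _ _ Tl).
  suff -> : S \o f = T \o f by rewrite subrr addr0.
  by apply/funext => i /=.
apply: le_trans (rnormD _ _) _; rewrite rnormN mulrDl.
by apply: lerD; [apply: le_trans (hM _) _|apply: le_trans (hN _) _];
  rewrite ler_wpM2l // ltW.
Qed.

Lemma total_inner_inj X H (f : X -> H) x y :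
  total_family f -> (forall i, inner x (f i) = inner y (f i)) -> x = y.
Proof.
move=> ft xy; apply: inner_inj => z; apply/eqP; rewrite -subr_eq0; apply/eqP.
apply: (@rnorm_harmonic _ _ _ (rnorm (x - y))) => // n.
have [l zl] := ft z _ (@invS_gt0 R n).
have -> : inner x z - inner y z = inner (x - y) (z - lincomb f l).
  rewrite [RHS]innerBr -innerBl [X in _ = _ - X](_ : _ = 0) ?subr0 //.
  rewrite -[x - y](lincomb1 (fun=> x - y) tt) inner_conj.
  elim: l {zl} => [|p l IH].
    by rewrite /lincomb !big_nil inner_conj inner0r !rmorph0.
  move: IH; rewrite !lincomb1 /lincomb big_cons innerDl rmorphD /= => ->.
  by rewrite addr0 innerZl inner_conj innerBl xy subrr !rmorph0 mulr0 rmorph0.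
by apply: le_trans (Cauchy_Schwarz _ _) _; rewrite ler_wpM2l // ltW.
Qed.

(** The graph of the extension is the closure of the set of pairs
    (lincomb f l, lincomb g l), so its values need no choice of approximating
    sequences. *)
Lemma total_extension X H K (f : X -> H) (g : X -> K) (M : R) :
  0 <= M -> total_family f ->
  (forall l, rnorm (lincomb g l) <= M * rnorm (lincomb f l)) ->
  exists T : H -> K, bounded_operator T /\ forall i, T (f i) = g i.
Proof.
move=> M0 ft fg.
pose G x y := forall e : R, 0 < e ->
  exists l, rnorm (x - lincomb f l) <= e /\ rnorm (y - lincomb g l) <= e.
(* The relation G is linear, and the bound M makes it single-valued. *)
have GD c x y x' y' : G x y -> G x' y' -> G (c *: x + x') (c *: y + y').
  move=> h h' e e0; have c0 : 0 < rnorm c + 1 by rewrite ltr_wpDl.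
  have [l [h1 h2]] := h _ (divr_gt0 (divr_gt0 e0 c0) (ltr0n R 2)).
  have [l' [h3 h4]] := h' _ (divr_gt0 e0 (ltr0n R 2)).
  exists (scale_comb c l ++ l'); rewrite !lincomb_cat !lincomb_scale.
  rewrite !opprD ![_ + (- _ - _)]addrACA -!scalerBr.
  have sum d : d <= e / (rnorm c + 1) / 2 -> 0 <= d -> rnorm c * d <= e / 2.
    move=> hd d0; rewrite ler_pdivlMr //; move: hd.
    by rewrite ler_pdivlMr // ler_pdivlMr // => hd; nra.
  have half : e = e / 2 + e / 2 by rewrite -splitr.
  by split; apply: le_trans (rnormD _ _) _; rewrite rnormZ [leRHS]half lerD // sum.
have Gnorm x y : G x y -> rnorm y <= M * rnorm x.
  move=> h; apply: (@le_harmonic _ _ _ (M + 1)); first exact: addr_ge0.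
  move=> n; have [l [h1 h2]] := h _ (@invS_gt0 R n).
  have := fg l; have := rnormD (y - lincomb g l) (lincomb g l).
  have := rnormD x (- (x - lincomb f l)); rewrite rnormN subrK opprB addrC subrK.
  move: h1 h2; move: (rnorm _) (rnorm _) (n.+1%:R^-1) (rnorm _) (rnorm _) (rnorm _).
  move=> *; nra.
have Guniq x y y' : G x y -> G x y' -> y = y'.
  move=> h h'; apply/eqP; rewrite -subr_eq0; apply/eqP/rnorm_eq0.
  have := GD (-1) _ _ _ _ h' h; rewrite !scaleN1r addNr addrC => /Gnorm.
  by rewrite rnorm0 mulr0 => h0; apply/eqP; rewrite eq_le h0 rnorm_ge0.
have /choice[T hT] x : exists y, G x y.
  have /choice[l hl] n : exists l, rnorm (x - lincomb f l) <= n.+1%:R^-1.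
    by have [l /ltW hl] := ft x _ (@invS_gt0 R n); exists l.
  have [||y hy] := @hilbert_limit _ _ (fun n => lincomb g (l n)) M => //.
    move=> m n; have := fg (l m ++ scale_comb (-1) (l n)).
    rewrite !lincomb_cat !lincomb_scale !scaleN1r => /le_trans; apply.
    rewrite ler_wpM2l //; apply: le_trans (rdistD x _ _) _.
    by rewrite lerD // rdistC.
  exists y => e e0.
  have [n hn] := @harmonic_scaled_lt _ (M + 1) e (addr_ge0 M0 ler01) e0.
  have n0 := @invS_gt0 R n; exists (l n); split.
    by apply: le_trans (hl n) _; move: hn n0; move: (n.+1%:R^-1) => p; nra.
  rewrite rdistC; apply: le_trans (hy n) _.
  by move: hn n0; move: (n.+1%:R^-1) => p; nra.
exists T; split.
  apply/boundedP; split; first by move=> c x y; apply: Guniq (hT _) _; exact: GD.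
  by exists M => // x; exact: Gnorm.
move=> i; apply: Guniq (hT _) _ => e e0; exists [:: (1, i)].
by rewrite !lincomb1 !subrr !rnorm0 ltW.
Qed.

(** The contraction sending f to g has an adjoint that sends g back to f: the
    two Gram matrices agree, and f is total. So adj T o T is the identity. *)
Lemma gram_isometry X H K (f : X -> H) (g : X -> K) :
  total_family f -> (forall i j, inner (g i) (g j) = inner (f i) (f j)) ->
  exists T : H -> K, linear_isometry T /\ forall i, T (f i) = g i.
Proof.
move=> ft fg; have [l|T [Tb Tf]] := @total_extension X H K f g 1 ler01 ft.
  rewrite mul1r -(@ler_pXn2r _ 2) // ?nnegrE //.
  rewrite -lecR -!inner_self !inner_lincomb.
  by under eq_bigr do under eq_bigr do rewrite fg.
exists T; split=> //; split; first by case: Tb.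
have TT : adj T \o T =1 id.
  apply: (total_bounded_eq ft); [|exact: bounded_id|].
    exact: bounded_comp (bounded_adj Tb) Tb.
  by move=> i /=; apply: (total_inner_inj ft) => j; rewrite adjP // !Tf fg.
move=> x; rewrite !rnormE; congr _%:C; apply/eqP.
rewrite -(@eqrXn2 _ 2) //; apply/eqP; apply: complexI.
by rewrite -!inner_self -adjPr //; move: (TT x) => /= ->.
Qed.

Lemma gram_unitary X H K (f : X -> H) (g : X -> K) :
  total_family f -> total_family g ->
  (forall i j, inner (g i) (g j) = inner (f i) (f j)) ->
  exists W : H -> K, unitary W /\ forall i, W (f i) = g i.
Proof.
move=> ft gt fg; have [W [Wi Wf]] := gram_isometry ft fg.
have Wb := isometry_bounded Wi; exists W; split=> //; split=> //.
  by move=> x /=; rewrite isometry_adjK.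
apply: (total_bounded_eq gt); [|exact: bounded_id|].
  exact: bounded_comp Wb (bounded_adj Wb).
by move=> i /=; rewrite -Wf isometry_adjK.
Qed.

End Totality.

(** * The Hilbert space of a positive definite kernel *)
Section Gram.
Variables (R : realType) (X : Type) (k : X -> X -> R[i]).
Implicit Types (f g : X -> R[i]) (l m : seq (R[i] * X)).

(** In the completion constructed below this is the inner product of the formal
    combination l with f, whence the conjugates. *)
Definition pairing f l : R[i] := \sum_(p <- l) Num.conj p.1 * f p.2.

Definition gram l m : R[i] := pairing (lincomb (fun y x => k x y) m) l.

Lemma pairing_cat f l m : pairing f (l ++ m) = pairing f l + pairing f m.
Proof. exact: big_cat. Qed.

Lemma pairing_scale f c l :
  pairing f (scale_comb c l) = Num.conj c * pairing f l.
Proof.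
rewrite /pairing big_map mulr_sumr; apply: eq_bigr => p _.
by rewrite rmorphM /= mulrA.
Qed.

Lemma pairing1 f x : pairing f [:: (1, x)] = f x.
Proof. by rewrite /pairing big_seq1 rmorph1 mul1r. Qed.

Lemma pairing_linear c f g l :
  pairing (c *: f + g) l = c * pairing f l + pairing g l.
Proof.
rewrite /pairing mulr_sumr -big_split; apply: eq_bigr => p _ /=.
by rewrite mulrDr mulrCA.
Qed.

Lemma pairingB f g l : pairing (f - g) l = pairing f l - pairing g l.
Proof. by rewrite addrC -scaleN1r pairing_linear mulN1r addrC. Qed.

Lemma gramE l m :
  gram l m = \sum_(p <- l) \sum_(q <- m) Num.conj p.1 * q.1 * k p.2 q.2.
Proof.
apply: eq_bigr => p _; elim: m => [|q m IH].
  by rewrite /lincomb !big_nil mulr0.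
by move: IH; rewrite /lincomb !big_cons -mulrA => <-; rewrite -mulrDr.
Qed.

Lemma gram_catl l l' m : gram (l ++ l') m = gram l m + gram l' m.
Proof. exact: pairing_cat. Qed.

Lemma gram_scalel c l m : gram (scale_comb c l) m = Num.conj c * gram l m.
Proof. exact: pairing_scale. Qed.

Lemma gram_catr l m m' : gram l (m ++ m') = gram l m + gram l m'.
Proof.
by rewrite /gram lincomb_cat -{1}[lincomb _ m]scale1r pairing_linear mul1r.
Qed.

Lemma gram_scaler c l m : gram l (scale_comb c m) = c * gram l m.
Proof.
rewrite /gram lincomb_scale -[c *: _]addr0 pairing_linear.
by rewrite [X in _ + X]big1 ?addr0 // => p _; rewrite mulr0.
Qed.

Definition positive_definite := forall l, 0 <= gram l l.

End Gram.

Section GramNorm.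
Variables (R : realType) (X : Type) (k : X -> X -> R[i]).
Hypothesis kpos : positive_definite k.
Implicit Types (f g : X -> R[i]) (l m : seq (R[i] * X)).

Local Notation G := (gram k).
Definition gram_norm l := Num.sqrt (complex.Re (gram k l l)).

Lemma gram_norm_ge0 l : 0 <= gram_norm l. Proof. exact: sqrtr_ge0. Qed.
Local Hint Resolve gram_norm_ge0 : core.

Lemma gram_self l : G l l = (gram_norm l ^+ 2)%:C.
Proof.
have := kpos l; rewrite /gram_norm; case: (gram k l l) => a b.
by rewrite lecE /= => /andP[/eqP-> a0]; rewrite sqr_sqrtr.
Qed.

Lemma gram_expand t l m : G (l ++ scale_comb t m) (l ++ scale_comb t m) =
  (gram_norm l ^+ 2)%:C + (t * G l m + Num.conj t * G m l) +
  (rnorm t ^+ 2 * gram_norm m ^+ 2)%:C.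
Proof.
rewrite gram_catl !gram_catr !gram_scalel !gram_scaler.
rewrite [(rnorm t ^+ 2 * _)%:C]rmorphM /= rnorm_sqr.
by rewrite -!gram_self; ring.
Qed.

(** The form takes real values at l + t m; t = 1 and t = 'i give the two
    components of the symmetry. *)
Lemma gram_conj l m : G m l = Num.conj (G l m).
Proof.
have h t : complex.Im (t * G l m + Num.conj t * G m l) = 0.
  have := gram_self (l ++ scale_comb t m); rewrite gram_expand.
  by move/(congr1 (@complex.Im R)); rewrite !raddfD /=; lra.
have := h 1; have := h 'i; move: (G l m) (G m l) => [a b] [c d] /=.
by move=> h1 h2; apply/eqP; rewrite eq_complex /=; apply/andP; split; apply/eqP; lra.
Qed.

Lemma gram_Cauchy_Schwarz l m : rnorm (G l m) <= gram_norm l * gram_norm m.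
Proof.
rewrite -(@ler_pXn2r _ 2) // ?nnegrE ?mulr_ge0 // exprMn.
apply: quadratic_bound => [|t]; first exact: sqr_ge0.
have := kpos (l ++ scale_comb t m); rewrite gram_expand (gram_conj l m) -rmorphM.
rewrite lecE => /andP[_]; rewrite !raddfD /=.
by case: (t * G l m) => a b; rewrite mulr2n.
Qed.

(** The distance from f to the combination l is measured by testing both
    against combinations m, as in the dual of the space of combinations. *)
Definition approximates (e : R) l f :=
  forall m, rnorm (pairing f m - G m l) <= e * gram_norm m.

Definition approximable f := forall e : R, 0 < e -> exists l, approximates e l f.

Lemma gram_norm_dual e l : 0 <= e ->
  (forall m, rnorm (G m l) <= e * gram_norm m) -> gram_norm l <= e.
Proof.
move=> e0 /(_ l); rewrite gram_self rnorm_real ger0_norm ?sqr_ge0 //.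
have := gram_norm_ge0 l; rewrite le_eqVlt => /orP[/eqP<- //|l0].
by rewrite expr2 ler_pM2r.
Qed.

Lemma approximates_diff e e' l l' f : 0 <= e -> 0 <= e' ->
  approximates e l f -> approximates e' l' f ->
  gram_norm (l ++ scale_comb (-1) l') <= e + e'.
Proof.
move=> e0 e0' h h'; apply: gram_norm_dual => [|m]; first exact: addr_ge0.
rewrite gram_catr gram_scaler mulN1r mulrDl.
apply: le_trans (rdistD (pairing f m) _ _) _.
by apply: lerD; rewrite // rdistC.
Qed.

Lemma approximates_gnorm e l f m : approximates e l f ->
  rnorm (pairing f m) <= (e + gram_norm l) * gram_norm m.
Proof.
move=> h; rewrite -[pairing f m](subrK (G m l)); apply: le_trans (rnormD _ _) _.
by rewrite mulrDl lerD // [leRHS]mulrC gram_Cauchy_Schwarz.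
Qed.

Lemma approximable_linear c f g :
  approximable f -> approximable g -> approximable (c *: f + g).
Proof.
move=> hf hg e e0; have c0 : 0 < rnorm c + 1 by rewrite ltr_wpDl.
have [l hl] := hf _ (divr_gt0 (divr_gt0 e0 (ltr0n R 2)) c0).
have [l' hl'] := hg _ (divr_gt0 e0 (ltr0n R 2)).
exists (scale_comb c l ++ l') => m.
rewrite pairing_linear gram_catr gram_scaler opprD addrACA -mulrBr.
apply: le_trans (rnormD _ _) _.
rewrite rnormM [e in leRHS](splitr e) mulrDl lerD //.
apply: le_trans (ler_wpM2l (rnorm_ge0 c) (hl m)) _.
rewrite mulrA ler_wpM2r // mulrCA -ler_pdivlMl ?divr_gt0 //.
rewrite mulVf ?gt_eqF ?divr_gt0 //.
by rewrite ler_pdivrMr // mul1r lerDl.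
Qed.

Lemma approximable0 : approximable 0.
Proof.
move=> e e0; exists [::] => m; rewrite gramE.
rewrite [X in _ - X]big1 ?subr0 => [|p _]; last by rewrite big_nil.
by rewrite /pairing big1 ?rnorm0 ?mulr_ge0 ?(ltW e0) // => p _; rewrite mulr0.
Qed.

Lemma approximable_lincomb l : approximable (lincomb (fun y x => k x y) l).
Proof.
by move=> e e0; exists l => m; rewrite subrr rnorm0 mulr_ge0 ?(ltW e0).
Qed.

End GramNorm.

Section KernelSpace.
Variables (R : realType) (X : Type) (k : X -> X -> R[i]).

Definition approximable_pred : {pred X -> R[i]} := fun f => `[< approximable k f >].

Fact approximable_submod_closed : submod_closed approximable_pred.
Proof.
split; first by apply/asboolP; exact: approximable0.
by move=> c f g /asboolP hf /asboolP hg; apply/asboolP; exact: approximable_linear.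
Qed.

HB.instance Definition _ := GRing.isSubmodClosed.Build R[i] (X -> R[i])
  approximable_pred approximable_submod_closed.

(** The completion of the formal combinations, realized inside their dual: it
    consists of the functions that combinations of the k^~ y approximate. No
    quotient is taken, since a combination of norm zero induces the zero
    function. The norm depends on the positivity of k, which is therefore a
    parameter of the type. *)
Record kernel_space (kpos : positive_definite k) := KernelSpace {
  kernel_fun : X -> R[i];
  _ : kernel_fun \in approximable_pred
}.

Hypothesis kpos : positive_definite k.

HB.instance Definition _ := [isSub for @kernel_fun kpos].
HB.instance Definition _ := [Choice of kernel_space kpos by <:].
HB.instance Definition _ := [SubChoice_isSubLmodule of kernel_space kpos by <:].

Local Notation E := (kernel_space kpos).
Local Notation G := (gram k).
Local Notation gram_norm := (gram_norm k).
Implicit Types f g : E.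

Let approximableP f : approximable k (val f).
Proof. by apply/asboolP; exact: (valP f). Qed.

Let approximants_subproof f : exists u : nat -> seq (R[i] * X),
  forall n, approximates k n.+1%:R^-1 (u n) (val f).
Proof.
have /choice[u hu] n : exists l, approximates k n.+1%:R^-1 l (val f).
  exact: approximableP (@invS_gt0 R n).
by exists u.
Qed.

Definition approximants f := sval (cid (approximants_subproof f)).

Lemma approximantsP f n : approximates k n.+1%:R^-1 (approximants f n) (val f).
Proof. exact: svalP (cid (approximants_subproof f)) n. Qed.

Lemma pairing_bound f : exists2 M : R, 0 <= M &
  forall l, rnorm (pairing (val f) l) <= M * gram_norm l.
Proof.
exists (1%:R^-1 + gram_norm (approximants f 0)) => [|l].
  by rewrite addr_ge0 ?sqrtr_ge0 // invr_ge0.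
by apply: approximates_gnorm => //; exact: approximantsP.
Qed.

Lemma approximants_bound f : exists2 M : R, 0 <= M &
  forall n, gram_norm (approximants f n) <= M.
Proof.
have [M M0 hM] := pairing_bound f; exists (1 + M) => [|n]; first exact: addr_ge0.
apply: (gram_norm_dual kpos) => [|m]; first exact: addr_ge0.
rewrite -[G _ _](subrK (pairing (val f) m)); apply: le_trans (rnormD _ _) _.
rewrite mulrDl lerD // rdistC; apply: le_trans (approximantsP f n m) _.
rewrite ler_wpM2r ?sqrtr_ge0 // invf_le1 ?ltr0n // ler1n //.
Qed.

(** The inner product of f and g is the limit of the pairings of g with the
    chosen approximants of f. *)
Definition is_inner f g (z : R[i]) := exists2 c : R, 0 <= c &
  forall n, rnorm (pairing (val g) (approximants f n) - z) <= c * n.+1%:R^-1.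

Definition kernel_inner f g : R[i] := xget 0 [set z | is_inner f g z].

Lemma kernel_innerP f g : is_inner f g (kernel_inner f g).
Proof.
apply: (@xgetPex _ 0 [set z | is_inner f g z]) => /=.
have [M M0 hM] := pairing_bound g.
have [m n|z hz] := @complex_limit R (fun n => pairing (val g) (approximants f n)) M.
  have <- : pairing (val g) (approximants f m ++ scale_comb (-1) (approximants f n))
     = pairing (val g) (approximants f m) - pairing (val g) (approximants f n).
    by rewrite pairing_cat pairing_scale rmorphN rmorph1 mulN1r.
  apply: le_trans (hM _) _; rewrite ler_wpM2l //.
  by apply: (approximates_diff kpos) (approximantsP f m) (approximantsP f n);
    rewrite invr_ge0.
by exists z, (M *+ 2); rewrite ?mulrn_wge0.
Qed.

Lemma kernel_inner_unique f g z : is_inner f g z -> kernel_inner f g = z.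
Proof.
move=> [c c0 hc]; have [d d0 hd] := kernel_innerP f g.
apply/eqP; rewrite -subr_eq0; apply/eqP.
apply: (@rnorm_harmonic _ _ _ (d + c)) => [|n]; first exact: addr_ge0.
apply: le_trans (rdistD (pairing (val g) (approximants f n)) _ _) _.
by rewrite mulrDl lerD // rdistC.
Qed.

Lemma kernel_inner_linear f g h c :
  kernel_inner f (c *: g + h) = c * kernel_inner f g + kernel_inner f h.
Proof.
have [a a0 ha] := kernel_innerP f g; have [b b0 hb] := kernel_innerP f h.
apply: kernel_inner_unique; exists (rnorm c * a + b) => [|n].
  by rewrite addr_ge0 ?mulr_ge0.
rewrite linearP pairing_linear opprD addrACA -mulrBr.
apply: le_trans (rnormD _ _) _; rewrite rnormM mulrDl -mulrA.
by rewrite lerD // ler_wpM2l.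
Qed.

Lemma kernel_inner_conj f g : kernel_inner g f = Num.conj (kernel_inner f g).
Proof.
have [a a0 ha] := kernel_innerP f g.
have [P P0 hP] := approximants_bound f; have [Q Q0 hQ] := approximants_bound g.
apply: kernel_inner_unique; exists (Q + (P + a)) => [|n].
  by rewrite !addr_ge0.
set l := approximants f n; set m := approximants g n.
apply: le_trans (rdistD (G m l) _ _) _.
rewrite mulrDl lerD //.
  apply: le_trans (approximantsP f n m) _.
  by rewrite mulrC ler_wpM2r ?hQ // invr_ge0.
rewrite (gram_conj kpos) -rmorphB rnorm_conj.
apply: le_trans (rdistD (pairing (val g) l) _ _) _.
rewrite mulrDl lerD ?(ha n) // rdistC; apply: le_trans (approximantsP g n l) _.
by rewrite mulrC ler_wpM2r ?hP // invr_ge0.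
Qed.

Lemma kernel_inner_self_approx f : exists2 c : R, 0 <= c & forall n,
  rnorm ((gram_norm (approximants f n) ^+ 2)%:C - kernel_inner f f) <= c * n.+1%:R^-1.
Proof.
have [a a0 ha] := kernel_innerP f f; have [P P0 hP] := approximants_bound f.
exists (P + a) => [|n]; first exact: addr_ge0.
rewrite -(gram_self kpos); set l := approximants f n.
apply: le_trans (rdistD (pairing (val f) l) _ _) _.
rewrite mulrDl lerD ?(ha n) // rdistC; apply: le_trans (approximantsP f n l) _.
by rewrite mulrC ler_wpM2r ?hP // invr_ge0.
Qed.

Definition kernel_norm f : R := Num.sqrt (complex.Re (kernel_inner f f)).

Lemma kernel_norm_ge0 f : 0 <= kernel_norm f.
Proof. exact: sqrtr_ge0. Qed.

Lemma kernel_inner_self f : kernel_inner f f = (kernel_norm f ^+ 2)%:C.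
Proof.
have [c c0 hc] := kernel_inner_self_approx f.
have re0 : 0 <= complex.Re (kernel_inner f f).
  apply: (le_harmonic c0) => n.
  apply: le_trans (sqr_ge0 (gram_norm (approximants f n))) _.
  rewrite -lerBlDl; apply: le_trans (hc n); apply: le_trans (Re_le_rnorm _).
  by rewrite raddfB.
rewrite /kernel_norm sqr_sqrtr //.
have := kernel_inner_conj f f; case: (kernel_inner f f) => a b [] h.
by apply/eqP; rewrite eq_complex /= eqxx /=; apply/eqP; lra.
Qed.

Lemma kernel_normD_sqr f g t :
  (kernel_norm (f + t *: g) ^+ 2) = kernel_norm f ^+ 2 +
    complex.Re (t * kernel_inner f g) *+ 2 + rnorm t ^+ 2 * kernel_norm g ^+ 2.
Proof.
apply: complexI; rewrite -kernel_inner_self.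
have lin h a b c : kernel_inner (c *: a + b) h =
    Num.conj c * kernel_inner a h + kernel_inner b h.
  rewrite kernel_inner_conj kernel_inner_linear rmorphD rmorphM /=.
  by rewrite -!kernel_inner_conj.
rewrite addrC kernel_inner_linear !lin (kernel_inner_conj f g).
rewrite [RHS]rmorphD /= [(_ + complex.Re _ *+ 2)%:C]rmorphD /=.
rewrite [(rnorm t ^+ 2 * _)%:C]rmorphM /= rnorm_sqr -!kernel_inner_self.
have -> : (complex.Re (t * kernel_inner f g) *+ 2)%:C =
  t * kernel_inner f g + Num.conj (t * kernel_inner f g).
  case: (t * _) => a b; apply/eqP; rewrite eq_complex /= mulr2n.
  by apply/andP; split; apply/eqP; lra.
by rewrite rmorphM /=; ring.
Qed.

Lemma kernel_Cauchy_Schwarz f g :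
  rnorm (kernel_inner f g) <= kernel_norm f * kernel_norm g.
Proof.
rewrite -(@ler_pXn2r _ 2) // ?nnegrE ?mulr_ge0 ?kernel_norm_ge0 // exprMn.
apply: quadratic_bound => [|t]; first exact: sqr_ge0.
by rewrite -kernel_normD_sqr sqr_ge0.
Qed.

Lemma kernel_normD f g : kernel_norm (f + g) <= kernel_norm f + kernel_norm g.
Proof.
rewrite -(@ler_pXn2r _ 2) // ?nnegrE ?addr_ge0 ?kernel_norm_ge0 //.
rewrite -[g in X in X <= _]scale1r kernel_normD_sqr mul1r rnorm_real.
have := le_trans (Re_le_rnorm _) (kernel_Cauchy_Schwarz f g).
by rewrite normr1 !mulr2n; move: (complex.Re _) => a; nra.
Qed.

Lemma kernel_normZ c f : kernel_norm (c *: f) = rnorm c * kernel_norm f.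
Proof.
apply/eqP; rewrite -(@eqrXn2 _ 2) ?mulr_ge0 ?kernel_norm_ge0 //.
rewrite exprMn -[c *: f]add0r kernel_normD_sqr.
have in0 h : kernel_inner 0 h = 0.
  rewrite kernel_inner_conj (_ : kernel_inner h 0 = 0) ?rmorph0 //.
  apply: (addrI (kernel_inner h 0)).
  by have := kernel_inner_linear h 0 0 1; rewrite scaler0 !addr0 mul1r => <-.
by rewrite in0 mulr0 /kernel_norm in0 /= sqrtr0 expr0n /= mul0rn !add0r.
Qed.

End KernelSpace.

Section KernelHilbert.
Variables (R : realType) (X : Type) (k : X -> X -> R[i]).
Hypothesis kpos : positive_definite k.
Local Notation E := (kernel_space kpos).
Local Notation G := (gram k).
Local Notation gram_norm := (gram_norm k).
Implicit Types f g : E.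

Definition kernel_comb (l : seq (R[i] * X)) : E :=
  KernelSpace kpos (introT (asboolP _) (@approximable_lincomb R X k l)).

Lemma kernel_comb_approximates l : approximates k 0 l (val (kernel_comb l)).
Proof. by move=> m; rewrite subrr rnorm0 mul0r. Qed.

Lemma kernel_inner_comb l f : kernel_inner (kernel_comb l) f = pairing (val f) l.
Proof.
have [M M0 hM] := pairing_bound f.
apply: kernel_inner_unique; exists M => // n.
set u := approximants _ n.
have -> : pairing (val f) u - pairing (val f) l =
          pairing (val f) (u ++ scale_comb (-1) l).
  by rewrite pairing_cat pairing_scale rmorphN rmorph1 mulN1r.
apply: le_trans (hM _) _; rewrite ler_wpM2l //.
rewrite -[leRHS]addr0; apply: (approximates_diff kpos) (approximantsP _ n) _.
- by rewrite invr_ge0.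
- by [].
- exact: kernel_comb_approximates.
Qed.

Lemma kernel_norm_comb l : kernel_norm (kernel_comb l) = gram_norm l.
Proof. by rewrite /kernel_norm kernel_inner_comb. Qed.

Lemma pairing_le_norm f l : rnorm (pairing (val f) l) <= kernel_norm f * gram_norm l.
Proof.
rewrite -kernel_norm_comb -kernel_inner_comb mulrC; exact: kernel_Cauchy_Schwarz.
Qed.

(** The squared norm of f is the limit of its pairings with approximants u of
    f. Such a pairing is at most e times the norm of u, and that norm tends to
    the norm of f. *)
Lemma kernel_norm_dual f e : 0 <= e ->
  (forall m, rnorm (pairing (val f) m) <= e * gram_norm m) -> kernel_norm f <= e.
Proof.
move=> e0 h; have [a a0 ha] := kernel_innerP f f.
have N0 := kernel_norm_ge0 f.
suff : kernel_norm f ^+ 2 <= e * kernel_norm f.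
  move: N0; rewrite le_eqVlt => /orP[/eqP<- //|N0].
  by rewrite expr2 ler_pM2r.
apply: (@le_harmonic _ _ _ (e + a)) => [|n]; first exact: addr_ge0.
set u := approximants f n; have i0 : 0 <= n.+1%:R^-1 :> R by rewrite invr_ge0.
have un : gram_norm u <= kernel_norm f + n.+1%:R^-1.
  apply: (gram_norm_dual kpos) => [|m]; first exact: addr_ge0.
  rewrite -[G _ _](subrK (pairing (val f) m)) addrC.
  apply: le_trans (rnormD _ _) _; rewrite mulrDl lerD ?pairing_le_norm //.
  by rewrite rdistC; exact: approximantsP.
have : rnorm (kernel_inner f f) <= e * gram_norm u + a * n.+1%:R^-1.
  rewrite -[kernel_inner f f](subrK (pairing (val f) u)) addrC.
  by apply: le_trans (rnormD _ _) _; rewrite lerD // rdistC ha.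
rewrite kernel_inner_self rnorm_real ger0_norm ?sqr_ge0 // => /le_trans; apply.
rewrite mulrDl addrA lerD2r -mulrDr ler_wpM2l //.
Qed.

Let norm f : R[i] := (kernel_norm f)%:C.

Let normD f g : norm (f + g) <= norm f + norm g.
Proof. by rewrite /norm -rmorphD lecR kernel_normD. Qed.

Let normZ (c : R[i]) f : norm (c *: f) = `|c| * norm f.
Proof. by rewrite /norm kernel_normZ rmorphM /= rnormE. Qed.

Let norm_eq0 f : norm f = 0 -> f = 0.
Proof.
move=> /complexI f0; apply: val_inj; apply/funext => x /=.
rewrite -[LHS]pairing1; apply: rnorm_eq0; apply/eqP.
rewrite eq_le rnorm_ge0 andbT; apply: le_trans (pairing_le_norm _ _) _.
by rewrite f0 mul0r.
Qed.

HB.instance Definition _ :=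
  Lmodule_isNormed.Build R[i] E normD normZ norm_eq0.

Lemma rnorm_kernel f : rnorm f = kernel_norm f.
Proof. by []. Qed.

Let complete (F : set_system E) : ProperFilter F -> cauchy F -> cvg F.
Proof.
move=> FF /cauchyP Fc.
have /choice[u hu] n : exists f, F (ball f (n.+1%:R^-1)%:C).
  by apply: Fc; rewrite ltcR invS_gt0.
have udiff m n : rnorm (u m - u n) <= m.+1%:R^-1 + n.+1%:R^-1.
  have [h [/ball_rnorm hm /ball_rnorm hn]] := filter_ex (filterI (hu m) (hu n)).
  by apply: le_trans (rdistD h _ _) _; rewrite lerD // ltW // rdistC.
have pdiff l m n : rnorm (pairing (val (u m)) l - pairing (val (u n)) l) <=
    gram_norm l * (m.+1%:R^-1 + n.+1%:R^-1).
  have -> : pairing (val (u m)) l - pairing (val (u n)) l =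
            pairing (val (u m - u n)) l by rewrite raddfB pairingB.
  apply: le_trans (pairing_le_norm _ _) _.
  by rewrite mulrC ler_wpM2l ?sqrtr_ge0 // -rnorm_kernel.
(* The limit is taken pointwise; it remains in the space because the pairings
   with any combination converge uniformly in the norm of the combination. *)
have /choice[g hg] x : exists z, exists2 c : R, 0 <= c &
    forall n, rnorm (val (u n) x - z) <= c * n.+1%:R^-1.
  have [m n|z hz] := @complex_limit R (fun n => val (u n) x) (gram_norm [:: (1, x)]).
    by have := pdiff [:: (1, x)] m n; rewrite !pairing1.
  by exists z, (gram_norm [:: (1, x)] *+ 2); rewrite ?mulrn_wge0 ?sqrtr_ge0.
have pg l : exists2 c : R, 0 <= c &
    forall n, rnorm (pairing (val (u n)) l - pairing g l) <= c * n.+1%:R^-1.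
  elim: l => [|p l [c c0 hc]].
    by exists 0 => // n; rewrite /pairing !big_nil subrr rnorm0 mul0r.
  have [d d0 hd] := hg p.2; exists (rnorm p.1 * d + c) => [|n].
    by rewrite addr_ge0 ?mulr_ge0.
  rewrite /pairing !big_cons opprD addrACA -mulrBr.
  apply: le_trans (rnormD _ _) _; rewrite rnormM rnorm_conj mulrDl -mulrA.
  by rewrite lerD // ?ler_wpM2l // hc.
have ug n l : rnorm (pairing (val (u n)) l - pairing g l) <=
    n.+1%:R^-1 * gram_norm l.
  have [c c0 hc] := pg l.
  apply: (@le_harmonic _ _ _ (gram_norm l + c)) => [|m].
    by rewrite addr_ge0 ?sqrtr_ge0.
  apply: le_trans (rdistD (pairing (val (u m)) l) _ _) _.
  apply: le_trans (lerD (pdiff l n m) (hc m)) _.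
  by rewrite mulrDr mulrDl addrA [in leRHS]mulrC.
have g_approx : approximable k g.
  move=> e e0; have [|n hn] := @harmonic_scaled_lt R 2 e _ e0; first by [].
  exists (approximants (u n) n) => m.
  apply: le_trans (rdistD (pairing (val (u n)) m) _ _) _.
  apply: le_trans (lerD _ (approximantsP (u n) n m)) _.
    by rewrite rdistC; exact: ug.
  rewrite -mulrDl ler_wpM2r ?sqrtr_ge0 //; apply: le_trans (ltW hn).
  by rewrite mulr2n mulrDl mul1r.
pose gE : E := KernelSpace kpos (introT (asboolP _) g_approx).
have ugE n : rnorm (u n - gE) <= n.+1%:R^-1.
  apply: kernel_norm_dual => [|m]; first by rewrite invr_ge0.
  by rewrite raddfB /= pairingB; exact: ug.
apply/cvg_ex; exists gE; apply/fcvg_ballP => e e0.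
have eE : e = (rnorm e)%:C by rewrite -rnormE gtr0_norm.
have re0 : 0 < rnorm e by rewrite -ltcR -eE.
have [|n hn] := @harmonic_scaled_lt R 2 _ _ re0; first by [].
apply: filterS (hu n) => h /ball_rnorm hh; rewrite eE; apply/ball_rnorm.
apply: le_lt_trans hn; apply: le_trans (rdistD (u n) _ _) _.
rewrite mulr2n mulrDl mul1r lerD //; last exact: ltW.
by rewrite rdistC.
Qed.

HB.instance Definition _ := Uniform_isComplete.Build E complete.

Let inner_norm f : kernel_inner f f = `|f| ^+ 2.
Proof. by rewrite kernel_inner_self rnormE rmorphXn. Qed.

HB.instance Definition _ := CompleteNormedModule_isHilbert.Build R E
  (fun f g h c => kernel_inner_linear f g h c) (@kernel_inner_conj _ _ _ kpos)
  inner_norm.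

Definition kernel_embedding (x : X) : E := kernel_comb [:: (1, x)].

Lemma lincomb_kernel_embedding l : lincomb kernel_embedding l = kernel_comb l.
Proof.
have e x : (fun y => k y x) = val (kernel_embedding x).
  by rewrite /= (lincomb1 (fun y x => k x y)).
apply: val_inj; rewrite raddf_sum; apply: eq_bigr => p _.
by rewrite e.
Qed.

Lemma kernel_embedding_total :
  total_family (kernel_embedding : X -> (E : hilbertType R)).
Proof.
move=> f e /harmonic_lt[n hn]; exists (approximants f n); apply: le_lt_trans hn.
rewrite lincomb_kernel_embedding; apply: kernel_norm_dual => [|m].
  by rewrite invr_ge0.
by rewrite raddfB pairingB; exact: approximantsP.
Qed.

End KernelHilbert.

(** The family is x |-> k^~ x, with the reproducing property
    inner (k^~ x) f = f x. *)
Theorem Kolmogorov_decomposition (R : realType) (X : Type) (k : X -> X -> R[i]) :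
  positive_definite k ->
  exists (H : hilbertType R) (f : X -> H),
    total_family f /\ forall x y, inner (f x) (f y) = k x y.
Proof.
move=> kpos; exists (kernel_space kpos : hilbertType R), (kernel_embedding kpos).
split; first exact: kernel_embedding_total.
move=> x y; rewrite [LHS]kernel_inner_comb pairing1 /=.
by rewrite (lincomb1 (fun y x => k x y)).
Qed.

(** * Square roots in a C*-algebra *)
Section CstarAlgebra.
Variables (R : realType) (A : cstarAlgType R).
Implicit Types a b h : A.

Lemma starD a b : star (a + b) = star a + star b.
Proof. by rewrite -{1}[a]scale1r star_antilinear rmorph1 scale1r. Qed.

Lemma star0 : star (0 : A) = 0.
Proof. by apply: (addrI (star (0 : A))); rewrite -starD !addr0. Qed.

Lemma starZ (c : R[i]) a : star (c *: a) = Num.conj c *: star a.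
Proof. by rewrite -[c *: a]addr0 star_antilinear star0 addr0. Qed.

Lemma starN a : star (- a) = - star a.
Proof. by rewrite -scaleN1r starZ rmorphN rmorph1 scaleN1r. Qed.

Lemma star1 : star (1 : A) = 1.
Proof. by rewrite -[star 1]mulr1 -{2}[1]starK -starM mulr1 starK. Qed.

Local Notation N := (@cstar_norm R A).

Lemma cstar_normZ_real (r : R) a : N (r%:C *: a) = `|r| * N a.
Proof. by apply: complexI; rewrite cstar_normZ rnormE rnorm_real -rmorphM. Qed.

Lemma cstar_norm0 : N 0 = 0.
Proof. by rewrite -(scale0r (0 : A)) (cstar_normZ_real 0) normr0 mul0r. Qed.

Lemma cstar_normN a : N (- a) = N a.
Proof.
have -> : - a = (- 1)%:C *: a by rewrite rmorphN rmorph1 scaleN1r.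
by rewrite cstar_normZ_real normrN normr1 mul1r.
Qed.

Lemma cstar_norm_ge0 a : 0 <= N a.
Proof.
by have := cstar_normD a (- a); rewrite subrr cstar_norm0 cstar_normN; lra.
Qed.
Local Hint Resolve cstar_norm_ge0 : core.

Lemma cstar_distC a b : N (a - b) = N (b - a).
Proof. by rewrite -cstar_normN opprB. Qed.

Lemma cstar_distD c a b : N (a - b) <= N (a - c) + N (c - b).
Proof. by have := cstar_normD (a - c) (c - b); rewrite addrA subrK. Qed.

Lemma star_isometric a : N (star a) = N a.
Proof.
have le b : N b <= N (star b).
  have := cstar_normM (star b) b; rewrite cstar_identity.
  have := cstar_norm_ge0 b; rewrite le_eqVlt => /orP[/eqP<- //|b0].
  by rewrite expr2 ler_pM2r.
by apply/eqP; rewrite eq_le le -{2}[a]starK le.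
Qed.

Lemma cstar_norm_sqrB a b : N a <= 2^-1 -> N b <= 2^-1 ->
  N (a * a - b * b) <= N (a - b).
Proof.
move=> a2 b2; have -> : a * a - b * b = a * (a - b) + (a - b) * b.
  by rewrite mulrBr mulrBl addrA subrK.
apply: le_trans (cstar_normD _ _) _.
have := cstar_normM a (a - b); have := cstar_normM (a - b) b.
have := cstar_norm_ge0 (a - b); move: a2 b2.
by move: (N a) (N b) (N (a - b)) => p q r; nra.
Qed.

(** Picard iteration for z = (h + z ^ 2) / 2, a contraction of the ball of
    radius 1/2; then 1 - z is a square root of 1 - h. *)
Lemma cstar_sqrt h : star h = h -> N h <= 2^-1 ->
  exists y, star y = y /\ y * y = 1 - h.
Proof.
move=> hs hn.
pose half : R[i] := (2^-1)%:C.
have half2 a : half *: a + half *: a = a.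
  by rewrite -scalerDl -rmorphD /= -{2}[a]scale1r; congr (_%:C *: _); lra.
have Nhalf a : N (half *: a) = 2^-1 * N a.
  by rewrite cstar_normZ_real ger0_norm // invr_ge0.
pose z n := iter n (fun a => half *: (h + a * a)) 0.
have zS n : z n.+1 = half *: (h + z n * z n) by [].
have zn n : N (z n) <= 2^-1.
  elim: n => [|n IH]; first by rewrite cstar_norm0 invr_ge0.
  rewrite zS Nhalf; have := cstar_normD h (z n * z n).
  have := cstar_normM (z n) (z n); have := cstar_norm_ge0 (z n); move: IH hn.
  by move: (N h) (N (z n)) => p q; nra.
have zs n : star (z n) = z n.
  elim: n => [|n IH]; first exact: star0.
  by rewrite zS starZ starD starM hs IH conj_real.
have zd n : N (z n.+1 - z n) <= 2^-1 ^+ n.+1.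
  elim: n => [|n IH].
    by rewrite zS subr0 mulr0 addr0 Nhalf expr1; move: hn; lra.
  rewrite (zS n.+1) [X in _ - X]zS -scalerBr opprD addrACA subrr add0r Nhalf exprS.
  rewrite ler_wpM2l ?invr_ge0 //; apply: le_trans IH.
  exact: cstar_norm_sqrB.
have zD m n : N (z (n + m)%N - z n) <= 2^-1 ^+ n.
  have : N (z (n + m)%N - z n) <= 2^-1 ^+ n - 2^-1 ^+ (n + m).
    elim: m => [|m IH]; first by rewrite addn0 !subrr cstar_norm0.
    apply: le_trans (cstar_distD (z (n + m)%N) _ _) _.
    rewrite addnS; have := zd (n + m)%N; rewrite exprS.
    move: IH; move: (2^-1 ^+ (n + m)) (2^-1 ^+ n) => p q; lra.
  move/le_trans; apply; rewrite gerBl exprn_ge0 // invr_ge0 //.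
have small (e : R) : 0 < e -> exists n : nat, 2^-1 ^+ n < e.
  move=> e0; have [n hn'] := harmonic_lt e0; exists n; apply: le_lt_trans hn'.
  by rewrite exprVn lef_pV2 ?posrE ?exprn_gt0 ?ltr0n // -natrX ler_nat ltn_expl.
have [|l hl] := @cstar_complete R A z.
  move=> e e0; have [n hn'] := small _ (divr_gt0 e0 (ltr0n R 2)).
  exists n => p q np nq; apply: le_lt_trans (cstar_distD (z n) _ _) _.
  rewrite [N (z n - _)]cstar_distC -(subnKC np) -(subnKC nq).
  by rewrite [e]splitr; apply: ltrD; apply: le_lt_trans (zD _ _) hn'.
have {}hl (e : R) : 0 < e -> exists n : nat, N (z n - l) <= e /\ N (z n.+1 - l) <= e.
  move=> e0; have /cvgrPdist_le/(_ _ e0)[n _ hn'] := hl; exists n.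
  by split; [have := hn' n (leqnn n)|have := hn' n.+1 (leqnSn n)];
    rewrite /= sub0r normrN ger0_norm.
have zero a (c : R) : 0 <= c -> (forall e : R, 0 < e -> N a <= c * e) -> a = 0.
  move=> c0 ha; apply: cstar_norm0_eq0; apply/eqP.
  rewrite eq_le cstar_norm_ge0 andbT.
  by apply: (le_harmonic c0) => n; rewrite add0r ha // invS_gt0.
have l_small : N l <= 2^-1.
  apply/ler_addgt0Pr => e e0; have [n [h1 _]] := hl _ e0.
  have := cstar_normD (z n) (- (z n - l)); rewrite cstar_normN opprB addrC subrK.
  by have := zn n; move: h1; move: (N _) (N _) (N _) => p q r; lra.
have l_star : star l = l.
  apply/eqP; rewrite -subr_eq0; apply/eqP; apply: (zero _ 2) => // e e0.
  have [n [h1 _]] := hl _ e0.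
  have := cstar_distD (z n) (star l) l.
  rewrite -{1}[z n]zs -starN -starD star_isometric [N (l - _)]cstar_distC.
  by move: h1; move: (N _) (N _) => p q; lra.
have lfix : l + l = h + l * l.
  suff e : l = half *: (h + l * l) by rewrite {1 2}e half2.
  apply/eqP; rewrite -subr_eq0; apply/eqP; apply: (zero _ 2) => // e e0.
  have [n [h1 h2]] := hl _ e0.
  have := cstar_distD (z n.+1) l (half *: (h + l * l)).
  rewrite {2}zS -scalerBr opprD addrACA subrr add0r Nhalf [N (l - z _)]cstar_distC.
  have := cstar_norm_sqrB (zn n) l_small; move: h1 h2.
  by move: (N _) (N _) (N _) (N _) => p q r s; lra.
exists (1 - l); split; first by rewrite starD starN star1 l_star.
have -> : (1 - l) * (1 - l) = 1 - (l + l) + l * l.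
  by rewrite mulrBl mul1r mulrBr mulr1 opprB opprD !addrA addrAC.
by rewrite lfix opprD addrA subrK.
Qed.

(** For M > 2 |a|^2 the element star a * a / M has norm at most 1/2, so that
    1 - star a * a / M has a selfadjoint square root. *)
Lemma cstar_dominated a : exists M : R, 0 <= M /\
  exists y, M%:C *: 1 - star a * a = star y * y.
Proof.
pose M := N a ^+ 2 *+ 2 + 1.
have M0 : 0 < M by rewrite ltr_wpDl // mulrn_wge0 // sqr_ge0.
exists M; split; first exact: ltW.
pose h := M^-1%:C *: (star a * a).
have [||y [ys yy]] := @cstar_sqrt h.
- by rewrite /h starZ starM starK conj_real.
- rewrite /h cstar_normZ_real ger0_norm ?invr_ge0 ?(ltW M0) // cstar_identity.
  rewrite ler_pdivrMl // /M; move: (N a ^+ 2) (sqr_ge0 (N a)) => p p0; lra.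
exists ((Num.sqrt M)%:C *: y).
rewrite starZ conj_real -scalerAl -scalerAr scalerA -rmorphM /= -expr2.
rewrite sqr_sqrtr ?(ltW M0) //.
rewrite ys yy scalerBr; congr (_ - _); rewrite /h scalerA -rmorphM /= mulfV ?gt_eqF //.
by rewrite scale1r.
Qed.

End CstarAlgebra.

(** * Multi-time correlations of a C*-dynamical system *)
Section Correlation.
Variables (R : realType) (A : cstarAlgType R).
Variables (Phi : {linear A -> A}) (phi : {scalar A}).
Implicit Types (a b c : A) (s t : seq A).

(** The inner product of the word s with pi c applied to the word t, computed by
    removing n letters from each. The default value 1 of head pads the shorter
    of the two sequences; once both are exhausted, a further step replaces c by
    Phi c, which an invariant phi does not see. So n only has to bound the two
    lengths. *)
Fixpoint correlation_upto n c s t : R[i] :=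
  if n is m.+1 then
    correlation_upto m (Phi (star (head 1 s) * c * head 1 t)) (behead s) (behead t)
  else phi c.

Definition correlation c s t := correlation_upto (maxn (size s) (size t)) c s t.

(** An empty sequence counts as [:: 1], which is the same word because V and
    pi 1 fix Omega. *)
Definition mul_head a s := a * head 1 s :: behead s.

Lemma correlation_upto_linear n x a b s t :
  correlation_upto n (x *: a + b) s t =
  x * correlation_upto n a s t + correlation_upto n b s t.
Proof.
elim: n a b s t => [|n IH] a b s t /=; first by rewrite linearP.
by rewrite -IH mulrDr mulrDl -scalerAr -scalerAl linearP.
Qed.

Lemma correlation_linear x a b s t :
  correlation (x *: a + b) s t = x * correlation a s t + correlation b s t.
Proof. exact: correlation_upto_linear. Qed.

Lemma correlationZ x a s t : correlation (x *: a) s t = x * correlation a s t.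
Proof.
have K0 : correlation 0 s t = 0.
  apply: (addrI (correlation 0 s t)).
  by have := correlation_linear 1 0 0 s t; rewrite scaler0 !addr0 mul1r.
by rewrite -[x *: a]addr0 correlation_linear K0 addr0.
Qed.

Lemma correlationB a b s t :
  correlation (a - b) s t = correlation a s t - correlation b s t.
Proof. by rewrite addrC -scaleN1r correlation_linear mulN1r addrC. Qed.

(** One step turns the matrix B into Phi applied to the entries of
    D^* B D, where D is the diagonal matrix of the first letters: congruence
    preserves positivity, and Phi does so by complete positivity. *)
Lemma correlation_upto_positive (cpPhi : completely_positive Phi)
    (phi_ge0 : forall a, 0 <= phi (star a * a)) n N (B : 'M[A]_N)
    (s : 'I_N -> seq A) (x : 'I_N -> R[i]) :
  positive_mx B ->
  0 <= \sum_i \sum_j Num.conj (x i) * x j * correlation_upto n (B i j) (s i) (s j).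
Proof.
elim: n B s => [|n IH] B s [D BD] /=; last first.
  pose B' := \matrix_(i, j) (star (head 1 (s i)) * B i j * head 1 (s j)).
  have /cpPhi/(IH _ (behead \o s)) : positive_mx B'.
    exists (\matrix_(l, j) (D l j * head 1 (s j))); apply/matrixP => i j.
    rewrite !mxE BD mxE mulr_sumr mulr_suml; apply: eq_bigr => l _.
    by rewrite !mxE starM !mulrA.
  congr (is_true (0 <= _)); apply: eq_bigr => i _; apply: eq_bigr => j _.
  by rewrite !mxE.
have -> : \sum_i \sum_j Num.conj (x i) * x j * phi (B i j) =
    \sum_l phi (star (\sum_i x i *: D l i) * (\sum_j x j *: D l j)).
  rewrite BD.
  under [RHS]eq_bigr => l _.
    rewrite (big_morph _ (@starD R A) (@star0 R A)) mulr_suml linear_sum.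
    under eq_bigr => i _ do rewrite mulr_sumr linear_sum.
    over.
  rewrite [RHS]exchange_big; apply: eq_bigr => i _.
  rewrite [RHS]exchange_big; apply: eq_bigr => j _.
  rewrite mxE linear_sum mulr_sumr; apply: eq_bigr => l _ /=.
  rewrite !mxE starZ -[_ *: _ * _ in RHS]scalerAl -[_ * (_ *: _) in RHS]scalerAr.
  by rewrite scalerA [RHS]linearZ.
by apply: sumr_ge0 => l _.
Qed.

Hypothesis phi_inv : forall a, phi (Phi a) = phi a.

Lemma correlation_upto_stable n c s t : (size s <= n)%N -> (size t <= n)%N ->
  correlation_upto n.+1 c s t = correlation_upto n c s t.
Proof.
elim: n c s t => [|n IH] c s t.
  by rewrite !leqn0 => /nilP-> /nilP-> /=; rewrite star1 mul1r mulr1 phi_inv.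
by move=> sn tn; apply: IH; [case: s sn|case: t tn].
Qed.

Lemma correlationE n c s t : (size s <= n)%N -> (size t <= n)%N ->
  correlation c s t = correlation_upto n c s t.
Proof.
move=> sn tn; have : (maxn (size s) (size t) <= n)%N by rewrite geq_max sn.
move/subnKC <-; elim: (n - _)%N => [|m IH]; first by rewrite addn0.
by rewrite addnS correlation_upto_stable // -?IH //; apply: leq_trans (leq_addr _ _);
  rewrite ?leq_maxl ?leq_maxr.
Qed.

Lemma correlation_cons c a b s t :
  correlation c (a :: s) (b :: t) = correlation (Phi (star a * c * b)) s t.
Proof.
by rewrite (@correlationE (maxn (size s) (size t)).+1) //= ltnS
  ?leq_maxl ?leq_maxr.
Qed.

Let bound s t := (maxn (size s) (size t)).+1.

Let size_l s t : (size s <= bound s t)%N.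
Proof. by rewrite leqW // leq_maxl. Qed.

Let size_r s t : (size t <= bound s t)%N.
Proof. by rewrite leqW // leq_maxr. Qed.

Let size_mul_head a s n : (size s <= n.+1)%N -> (size (mul_head a s) <= n.+1)%N.
Proof. by case: s. Qed.

Lemma correlation_mul_headl c a s t :
  correlation c (mul_head a s) t = correlation (star a * c) s t.
Proof.
rewrite !(@correlationE (bound s t)) ?size_l ?size_r ?size_mul_head ?size_l //=.
by rewrite starM !mulrA.
Qed.

Lemma correlation_mul_headr c a s t :
  correlation c s (mul_head a t) = correlation (c * a) s t.
Proof.
rewrite !(@correlationE (bound s t)) ?size_l ?size_r ?size_mul_head ?size_r //=.
by rewrite !mulrA.
Qed.

Lemma correlation_positive (cpPhi : completely_positive Phi)
    (phi_ge0 : forall a, 0 <= phi (star a * a)) :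
  positive_definite (correlation 1).
Proof.
move=> l; rewrite gramE big_tnth; under eq_bigr do rewrite big_tnth.
set y := tnth (in_tuple l); set N := size l.
pose n := \max_(i < N) size (y i).2.
have yn i : (size (y i).2 <= n)%N by rewrite /n (bigD1 i) ?leq_maxl.
under eq_bigr => i _ do under eq_bigr => j _ do
  rewrite (correlationE _ (yn i) (yn j)).
(* The matrix of ones is D^* D for D with first row 1 and other rows 0. *)
have pos1 : positive_mx (const_mx 1 : 'M[A]_N).
  exists (\matrix_(p, q) ((p == 0 :> nat)%:R)); apply/matrixP => i j.
  have N0 : (0 < N)%N by apply: leq_ltn_trans (ltn_ord i).
  rewrite !mxE (bigD1 (Ordinal N0)) //= !mxE star1 mulr1 big1 ?addr0 // => p.
  by rewrite -val_eqE !mxE /= => /negbTE->; rewrite mulr0.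
have := correlation_upto_positive cpPhi phi_ge0 n
  (fun i => (y i).2) (fun i => (y i).1) pos1.
congr (is_true (0 <= _)); apply: eq_bigr => i _; apply: eq_bigr => j _.
by rewrite mxE.
Qed.

End Correlation.

(** * Words in a dilation *)
Section Representation.
Variables (R : realType) (A : cstarAlgType R) (H : hilbertType R).
Variables (pi : A -> H -> H) (Omega : H).
Hypothesis pi_repr : representation pi.

Lemma repr_inner a x y : inner (pi a x) y = inner x (pi (star a) y).
Proof. by rewrite repr_star // adjPr //; exact: repr_bounded. Qed.

Lemma GNS_gram (phi : {scalar A}) a b :
  (forall a, phi a = inner Omega (pi a Omega)) ->
  inner (pi a Omega) (pi b Omega) = phi (star a * b).
Proof. by move=> ->; rewrite repr_inner repr_mul. Qed.

Lemma GNS_total : cyclic_vector (range pi) Omega -> total_family (pi ^~ Omega).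
Proof.
move=> /denseP hd x e /(hd x)[_ [_ [a _ <-] <-] xe].
by exists [:: (1, a)]; rewrite (lincomb1 (pi^~ Omega)).
Qed.

End Representation.

Section Words.
Variables (R : realType) (A : cstarAlgType R).
Variables (Phi : {linear A -> A}) (phi : {scalar A}).
Variables (H : hilbertType R) (pi : A -> H -> H) (Omega : H) (V : H -> H).
Hypothesis pi_repr : representation pi.
Hypothesis V_isom : linear_isometry V.
Hypothesis V_fix : V Omega = Omega.
Hypothesis V_map : forall a, pi (Phi a) =1 adj V \o pi a \o V.
Implicit Types (a b c : A) (s t : seq A).

Let Vb : bounded_operator V := isometry_bounded V_isom.
Let Vl : linear V := bounded_linear Vb.
Let Vadj : bounded_operator (adj V) := bounded_adj Vb.
Let pib a : bounded_operator (pi a) := repr_bounded pi_repr a.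

Definition word s := foldr (fun a x => pi a (V x)) Omega s.

Lemma word_head s : word s = pi (head 1 s) (V (word (behead s))).
Proof. by case: s => [|a s] //=; rewrite repr_one // V_fix. Qed.

Lemma word_mul_head a s : pi a (word s) = word (mul_head a s).
Proof. by rewrite word_head /= repr_mul. Qed.

Lemma word_shift s : V (word s) = word (1 :: s).
Proof. by rewrite /= repr_one. Qed.

Lemma word_adj s : adj V (word s) = word (mul_head (Phi (head 1 s)) (behead s)).
Proof. by rewrite -word_mul_head V_map /= -word_head. Qed.

(** One letter of each word is removed at a time: pi is moved to the other side
    by repr_inner, and V by adjP, where it meets pi and the second V. *)
Lemma inner_word c s t : (forall a, phi a = inner Omega (pi a Omega)) ->
  (forall a, phi (Phi a) = phi a) ->
  inner (word s) (pi c (word t)) = correlation Phi phi c s t.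
Proof.
move=> phiE phi_inv.
rewrite /correlation.
move: (leq_maxl (size s) (size t)) (leq_maxr (size s) (size t)).
move: (maxn _ _) => n; elim: n c s t => [|n IH] c s t sn tn.
  by move: sn tn; rewrite !leqn0 => /nilP-> /nilP->; rewrite /= phiE.
rewrite /= -IH; [|by case: s sn|by case: t tn].
rewrite [word s]word_head [word t]word_head repr_inner //.
by rewrite V_map /= adjPr // repr_mul //= repr_mul.
Qed.

Let in_closed_span x :=
  forall e : R, 0 < e -> exists l, rnorm (x - lincomb word l) < e.

Let closed_span_word s : in_closed_span (word s).
Proof. by move=> e e0; exists [:: (1, s)]; rewrite lincomb1 subrr rnorm0. Qed.

Let closed_span_linear (c : R[i]) x y :
  in_closed_span x -> in_closed_span y -> in_closed_span (c *: x + y).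
Proof.
move=> hx hy e e0; have c0 : 0 < rnorm c + 1 by rewrite ltr_wpDl.
have [l hl] := hx _ (divr_gt0 (divr_gt0 e0 (ltr0n R 2)) c0).
have [m hm] := hy _ (divr_gt0 e0 (ltr0n R 2)).
exists (scale_comb c l ++ m).
rewrite lincomb_cat lincomb_scale opprD addrACA -scalerBr.
apply: le_lt_trans (rnormD _ _) _; rewrite rnormZ [ltRHS]splitr ler_ltD //.
move: hl; rewrite ltr_pdivlMr //; have := rnorm_ge0 (x - lincomb word l).
by move: (rnorm c) (rnorm_ge0 c) => p p0; move: (rnorm _) => q; nra.
Qed.

Let closed_span0 : in_closed_span 0.
Proof.
have := closed_span_linear (-1) (closed_span_word [::]) (closed_span_word [::]).
by rewrite scaleN1r addNr.
Qed.

Let closed_span_bounded (T : H -> H) : bounded_operator T ->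
  (forall s, in_closed_span (T (word s))) ->
  forall x, in_closed_span x -> in_closed_span (T x).
Proof.
move=> /boundedP[Tl [M M0 hM]] Tw x hx e e0.
have [n hn] := @harmonic_scaled_lt _ M (e / 2) M0 (divr_gt0 e0 (ltr0n R 2)).
have [l hl] := hx _ (@invS_gt0 R n).
have [m hm] : exists m, rnorm (T (lincomb word l) - lincomb word m) < e / 2.
  suff : in_closed_span (T (lincomb word l)) by apply; rewrite divr_gt0.
  rewrite lin_lincomb //; elim: l {hl} => [|p l IH].
    by rewrite /lincomb big_nil; exact: closed_span0.
  by rewrite /lincomb big_cons; apply: closed_span_linear => //; exact: Tw.
exists m; apply: le_lt_trans (rdistD (T (lincomb word l)) _ _) _.
rewrite [ltRHS]splitr ltrD // -linB //; apply: le_lt_trans (hM _) _.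
by apply: le_lt_trans hn; rewrite ler_wpM2l // ltW.
Qed.

Let closed_span_V x : in_closed_span x -> in_closed_span (V x).
Proof.
apply: (closed_span_bounded Vb) => s; rewrite word_shift.
exact: closed_span_word.
Qed.

Let closed_span_adjV x : in_closed_span x -> in_closed_span (adj V x).
Proof.
apply: (closed_span_bounded Vadj) => s; rewrite word_adj.
exact: closed_span_word.
Qed.

Let closed_span_pi a x : in_closed_span x -> in_closed_span (pi a x).
Proof.
apply: (closed_span_bounded (pib a)) => s; rewrite word_mul_head.
exact: closed_span_word.
Qed.

Let closed_span_iter (T : H -> H) n :
  (forall x, in_closed_span x -> in_closed_span (T x)) ->
  forall x, in_closed_span x -> in_closed_span (iter n T x).
Proof. by move=> hT x hx; elim: n => //= n IH; exact: hT. Qed.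

Lemma adj_translate n a :
  adj (iter n V \o pi a \o iter n (adj V)) =
  iter n V \o pi (star a) \o iter n (adj V).
Proof.
have Vnb := bounded_iter n Vb; have Vnab := bounded_iter n Vadj.
rewrite (adj_comp (bounded_comp Vnb (pib a)) Vnab) (adj_comp Vnb (pib a)).
rewrite (adj_iter _ Vadj) (adj_iter _ Vb) (adjK Vb).
by apply/funext => x /=; rewrite repr_star.
Qed.

Lemma translate_bounded n a :
  bounded_operator (iter n V \o pi a \o iter n (adj V)).
Proof.
exact: bounded_comp (bounded_comp (bounded_iter n Vb) (pib a)) (bounded_iter n Vadj).
Qed.

Lemma bounded_star_subalgebra : star_subalgebra (@bounded_operator R H H).
Proof.
split => //.
- exact: bounded0.
- exact: boundedD.
- exact: boundedZ.
- exact: bounded_comp.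
- exact: bounded_adj.
Qed.

Lemma smallest_star_subalgebra (G : set (H -> H)) :
  G `<=` @bounded_operator R H H ->
  star_subalgebra (smallest (@star_subalgebra R H) G).
Proof.
move=> Gb; split.
- by move=> T; apply; split=> //; exact: bounded_star_subalgebra.
- by move=> M [hM _]; exact: star_subalgebra0.
- by move=> S T hS hT M hM; apply: star_subalgebraD; [case: hM|exact: hS|exact: hT].
- by move=> c T hT M hM; apply: star_subalgebraZ; [case: hM|exact: hT].
- by move=> S T hS hT M hM; apply: star_subalgebraM; [case: hM|exact: hS|exact: hT].
- by move=> T hT M hM; apply: star_subalgebra_adj; [case: hM|exact: hT].
Qed.

Local Notation dilation_algebra := (smallest (@star_subalgebra R H) (translates pi V)).

(** The operators that preserve the closed span of the words together with
    their adjoints form a star-subalgebra. It contains the translates, because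
    pi a, V and adj V all send words to words. *)
Lemma word_total : cyclic_vector dilation_algebra Omega -> total_family word.
Proof.
pose N : set (H -> H) := [set T | [/\ bounded_operator T,
  forall x, in_closed_span x -> in_closed_span (T x) &
  forall x, in_closed_span x -> in_closed_span (adj T x)]].
have hN : star_subalgebra N.
  split.
  - by move=> T [].
  - split; [exact: bounded0|move=> *; exact: closed_span0|].
    by rewrite adj_zero => *; exact: closed_span0.
  - move=> S T [Sb hS hS'] [Tb hT hT']; split; first exact: boundedD.
      by move=> x hx; rewrite -[S x]scale1r; apply: closed_span_linear; auto.
    rewrite (adj_add Sb Tb) => x hx; rewrite -[adj S x]scale1r.
    by apply: closed_span_linear; auto.
  - move=> c T [Tb hT hT']; split; first exact: boundedZ.
      by move=> x hx; rewrite -[c *: _]addr0; apply: closed_span_linear; auto.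
    rewrite (adj_scale c Tb) => x hx; rewrite -[_ *: _]addr0.
    by apply: closed_span_linear; auto.
  - move=> S T [Sb hS hS'] [Tb hT hT']; split; first exact: bounded_comp.
      by move=> x hx; apply: hS; exact: hT.
    by rewrite (adj_comp Sb Tb) => x hx; apply: hT'; exact: hS'.
  - by move=> T [Tb hT hT']; split; rewrite ?adjK //; exact: bounded_adj.
have tN : translates pi V `<=` N.
  have ht n a x :
      in_closed_span x -> in_closed_span (iter n V (pi a (iter n (adj V) x))).
    move=> hx; apply: closed_span_iter closed_span_V _ _; apply: closed_span_pi.
    exact: closed_span_iter closed_span_adjV _ hx.
  move=> _ [n [a ->]]; split; [exact: translate_bounded|exact: ht|].
  by rewrite adj_translate; exact: ht.
move=> /denseP hd x e e0.
have [_ [T Talg <-] xT] := hd x _ (divr_gt0 e0 (ltr0n R 2)).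
have [_ hT _] : N T by apply: Talg.
have [l hl] := hT _ (closed_span_word [::]) _ (divr_gt0 e0 (ltr0n R 2)).
exists l; apply: le_lt_trans (rdistD (T Omega) _ _) _.
by rewrite [ltRHS]splitr ltrD.
Qed.

(** T |-> V o T o adj V is a homomorphism of star-algebras, as adj V o V is the
    identity, and it sends translates to translates. *)
Lemma algebra_shift (T : H -> H) :
  dilation_algebra T -> dilation_algebra (V \o T \o adj V).
Proof.
have tb : translates pi V `<=` @bounded_operator R H H.
  by move=> _ [n [a ->]]; exact: translate_bounded.
have hA := smallest_star_subalgebra tb.
pose N := [set T | bounded_operator T /\ dilation_algebra (V \o T \o adj V)].
suff hN : star_subalgebra N.
  have tN : translates pi V `<=` N.
    move=> _ [n [a ->]]; split; first exact: translate_bounded.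
    move=> M [_ tM]; apply: tM; exists n.+1, a.
    by apply/funext => x /=; rewrite -iterSr.
  by move=> hT; have [] : N T by apply: hT.
have conjb T' : bounded_operator T' -> bounded_operator (V \o T' \o adj V).
  by move=> hT; exact: bounded_comp (bounded_comp Vb hT) Vadj.
split.
- by move=> S [].
- split; first exact: bounded0.
  rewrite (_ : _ \o _ = fun=> 0); first exact: star_subalgebra0.
  by apply/funext => x /=; rewrite lin0.
- move=> S T' [Sb hS] [Tb hT]; split; first exact: boundedD.
  have := star_subalgebraD hA hS hT; congr (dilation_algebra _).
  by apply/funext => x /=; rewrite (linD Vl).
- move=> c T' [Tb hT]; split; first exact: boundedZ.
  have := star_subalgebraZ hA c hT; congr (dilation_algebra _).
  by apply/funext => x /=; rewrite (linZ Vl).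
- move=> S T' [Sb hS] [Tb hT]; split; first exact: bounded_comp.
  have := star_subalgebraM hA hS hT; congr (dilation_algebra _).
  by apply/funext => x /=; rewrite isometry_adjK.
- move=> T' [Tb hT]; split; first exact: bounded_adj.
  have := star_subalgebra_adj hA hT; congr (dilation_algebra _).
  by rewrite (adj_comp (bounded_comp Vb Tb) Vadj) (adj_comp Vb Tb) (adjK Vb).
Qed.

(** Since Omega is fixed by adj V as well, a word T Omega extended by the
    letter a is pi a (V (T (adj V Omega))). *)
Lemma total_word_cyclic : total_family word -> cyclic_vector dilation_algebra Omega.
Proof.
have tb : translates pi V `<=` @bounded_operator R H H.
  by move=> _ [n [a ->]]; exact: translate_bounded.
have hA := smallest_star_subalgebra tb.
have word_algebra s : exists2 T, dilation_algebra T & T Omega = word s.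
  have pi_algebra a : dilation_algebra (pi a).
    by move=> M [_ tM]; apply: tM; exists 0%N, a; apply/funext.
  elim: s => [|a s [T hT Ts]].
    by exists (pi 1) => //; rewrite repr_one.
  exists (pi a \o (V \o T \o adj V)).
    exact: (star_subalgebraM hA (pi_algebra a) (algebra_shift hT)).
  by rewrite /= -{1}V_fix isometry_adjK // Ts.
have lincomb_algebra l : exists2 T, dilation_algebra T & T Omega = lincomb word l.
  elim: l => [|p l [T hT Tl]].
    by exists (fun=> 0); [exact: star_subalgebra0|rewrite /lincomb big_nil].
  have [S hS Ss] := word_algebra p.2; exists (fun x => p.1 *: S x + T x).
    by apply: (star_subalgebraD hA) => //; exact: (star_subalgebraZ hA).
  by rewrite Ss Tl /lincomb big_cons.
move=> wt; apply/denseP => x e /(wt x)[l hl]; have [T hT Tl] := lincomb_algebra l.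
by exists (T Omega); [exists T|rewrite Tl].
Qed.

End Words.

(** * Existence and uniqueness of the dilation *)
Section Existence.
Variables (R : realType) (A : cstarAlgType R).
Variables (Phi : {linear A -> A}) (phi : {scalar A}).
Hypothesis hsys : cstar_dynamical_system Phi phi.
Variables (H : hilbertType R) (iota : seq A -> H).
Hypothesis iota_total : total_family iota.
Hypothesis iota_gram : forall s t,
  inner (iota s) (iota t) = correlation Phi phi 1 s t.
Implicit Types (a b c : A) (s t : seq A).

Let Phi1 : Phi 1 = 1. Proof. by case: hsys => -[]. Qed.
Let phi_inv a : phi (Phi a) = phi a. Proof. by case: hsys. Qed.

Local Notation K := (correlation Phi phi).

(** The kernel of the correlations is linear in its middle argument, which is
    star a * a after multiplying all first letters by a. Writing
    M - star a * a = star y * y shows that M |x|^2 - |pi a x|^2 is the square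
    norm obtained from multiplication by y. *)
Lemma mul_head_bounded a : exists T : H -> H,
  bounded_operator T /\ forall s, T (iota s) = iota (mul_head a s).
Proof.
have [M [M0 [y My]]] := cstar_dominated a.
apply: (total_extension (sqrtr_ge0 M) iota_total) => l.
rewrite -(@ler_pXn2r _ 2) // ?nnegrE ?mulr_ge0 ?sqrtr_ge0 //.
rewrite exprMn sqr_sqrtr // -lecR -subr_ge0.
rewrite [(M * _)%:C]rmorphM /= -!inner_self.
suff -> : M%:C * inner (lincomb iota l) (lincomb iota l) -
    inner (lincomb (iota \o mul_head a) l) (lincomb (iota \o mul_head a) l) =
    inner (lincomb (iota \o mul_head y) l) (lincomb (iota \o mul_head y) l).
  by rewrite inner_self lecR sqr_ge0.
rewrite !inner_lincomb mulr_sumr -sumrB; apply: eq_bigr => p _.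
rewrite mulr_sumr -sumrB; apply: eq_bigr => q _.
rewrite /= !iota_gram !correlation_mul_headl // !correlation_mul_headr // !mulr1.
rewrite -My correlationB correlationZ; ring.
Qed.

Let rep a : H -> H := sval (cid (mul_head_bounded a)).

Let rep_bounded a : bounded_operator (rep a).
Proof. by case: (svalP (cid (mul_head_bounded a))). Qed.

Let repE a s : rep a (iota s) = iota (mul_head a s).
Proof. by have [_] := svalP (cid (mul_head_bounded a)); exact. Qed.

Let iota_inj x y : (forall s, inner (iota s) x = inner (iota s) y) -> x = y.
Proof.
move=> h; apply: (total_inner_inj iota_total) => s.
by rewrite inner_conj h -inner_conj.
Qed.

Let iota_mul_head a s t : inner (iota s) (iota (mul_head a t)) = K a s t.
Proof. by rewrite iota_gram correlation_mul_headr // mul1r. Qed.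

Let rep_representation : representation rep.
Proof.
split=> [//|c a b x|a b x|x|a x].
- move: x; apply: (total_bounded_eq iota_total) => //.
    exact: boundedD (boundedZ c _) _.
  move=> s; apply: iota_inj => t; rewrite !repE innerDr innerZr !iota_mul_head.
  exact: correlation_linear.
- move: x; apply: (total_bounded_eq iota_total) => //.
    exact: bounded_comp.
  by move=> s /=; rewrite !repE /mul_head /= mulrA.
- move: x; apply: (total_bounded_eq iota_total) => //; first exact: bounded_id.
  by move=> s; apply: iota_inj => t; rewrite repE iota_mul_head iota_gram.
- move: x; apply: (total_bounded_eq iota_total) => //; first exact: bounded_adj.
  move=> s; apply: iota_inj => t; rewrite repE adjPr // repE iota_mul_head.
  by rewrite iota_gram correlation_mul_headl // mulr1.
Qed.

(** Both operators are defined on the total family: V by s |-> 1 :: s, which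
    preserves correlations because Phi 1 = 1, and pi a by mul_head a. *)
Lemma dilation_existence : exists (pi : A -> H -> H) (V : H -> H),
  [/\ representation pi, linear_isometry V,
      forall s, word pi (iota [::]) V s = iota s,
      V (iota [::]) = iota [::] &
      forall a, pi (Phi a) =1 adj V \o pi a \o V].
Proof.
have [i j|V [Vi VE]] := @gram_isometry R _ H H iota (fun s => iota (1 :: s)) iota_total.
  by rewrite !iota_gram correlation_cons // star1 mulr1 mul1r Phi1.
have Vb := isometry_bounded Vi.
have V0 : V (iota [::]) = iota [::].
  rewrite VE; apply: iota_inj => t.
  have -> : [:: 1] = mul_head 1 [::] :> seq A by rewrite /mul_head mulr1.
  by rewrite iota_mul_head iota_gram.
exists rep, V; split; [exact: rep_representation|exact: Vi| |exact: V0|].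
- elim=> [//|a s IH] /=; rewrite IH VE repE /mul_head /= mulr1 //.
- move=> a; apply: (total_bounded_eq iota_total) => //.
    exact: bounded_comp (bounded_comp (bounded_adj Vb) (rep_bounded a)) Vb.
  move=> s /=; apply: iota_inj => t; rewrite adjPr // !VE !repE iota_mul_head.
  by rewrite iota_gram /mul_head /= correlation_cons // star1 !mul1r mulr1.
Qed.

End Existence.

Theorem theorem1 (R : realType) (A : cstarAlgType R)
    (Phi : {linear A -> A}) (phi : {scalar A})
    (hsys : cstar_dynamical_system Phi phi)
    (Hphi : hilbertType R) (piphi : A -> Hphi -> Hphi) (Omegaphi : Hphi)
    (hGNS : GNS_triple phi piphi Omegaphi)
    (U : Hphi -> Hphi) (hU : GNS_contraction Phi piphi Omegaphi U) :
  exists (Hoo : hilbertType R) (pioo : A -> Hoo -> Hoo) (Omegaoo : Hoo)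
      (Z0 : Hphi -> Hoo),
    [/\ linear_isometry Z0,
        representation pioo,
        forall a : A, pioo a \o Z0 =1 Z0 \o piphi a,
        Omegaoo = Z0 Omegaphi
      & exists Voo : Hoo -> Hoo,
        [/\ linear_isometry Voo,
            isometric_dilation Phi phi U Z0 pioo Omegaoo Voo
          & forall (H : hilbertType R) (pi : A -> H -> H) (Omega : H)
              (V : H -> H),
            representation pi -> linear_isometry V ->
            (exists Z : Hphi -> H,
               linear_isometry Z /\ isometric_dilation Phi phi U Z pi Omega V) ->
            exists W : Hoo -> H,
              [/\ unitary W,
                  forall a : A, W \o pioo a =1 pi a \o W,
                  W Omegaoo = Omega
                & W \o Voo =1 V \o W]]].
Proof.
have [[Phi1 cpPhi] [phi_ge0 phi1] phi_inv] := hsys.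
have [H [iota [it ig]]] := Kolmogorov_decomposition
  (correlation_positive phi_inv cpPhi phi_ge0).
have [pi [V [hpi hV hword V0 hmap]]] := dilation_existence hsys it ig.
pose Omega := iota [::].
have Vb := isometry_bounded hV.
have st a : phi a = inner Omega (pi a Omega).
  have -> : pi a Omega = iota (mul_head a [::]) by rewrite -hword -word_mul_head.
  by rewrite ig correlation_mul_headr // mul1r.
have [hpiphi stphi /GNS_total tphi] := hGNS.
have [b c|Z [Zi ZE]] := @gram_isometry R _ Hphi H _ (pi ^~ Omega) tphi.
  by rewrite (GNS_gram hpi _ _ st) (GNS_gram hpiphi _ _ stphi).
have Zb := isometry_bounded Zi.
have [Ul Ubd UE] := hU.
have Ub : bounded_operator U by split=> //; exists 1 => x; rewrite mul1r.
have ZUn n x : Z (iter n U x) = iter n (adj V) (Z x).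
  elim: n => //= n <-; move: (iter n U x).
  apply: (total_bounded_eq tphi); first exact: bounded_comp Zb Ub.
    exact: bounded_comp (bounded_adj Vb) Zb.
  by move=> a /=; rewrite UE !ZE hmap /= V0.
exists H, pi, Omega, Z; split=> //.
- move=> a; apply: (total_bounded_eq tphi).
  + exact: bounded_comp (repr_bounded hpi a) Zb.
  + exact: bounded_comp Zb (repr_bounded hpiphi a).
  + by move=> b /=; have /= <- := repr_mul hpiphi a b Omegaphi; rewrite !ZE repr_mul.
- by rewrite -[Omegaphi](repr_one hpiphi) ZE repr_one.
exists V; split=> //.
  split=> //.
  (* This is the adjoint of ZUn, composed with Z. *)
  - move=> n y /=; apply: inner_inj => x.
    rewrite -(adj_iter n Ub) adjP ?adjP //; last exact: bounded_iter.
    rewrite -(isometry_inner y _ Zi) ZUn -(adj_iter n Vb) adjPr //.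
    exact: bounded_iter.
  - apply: total_word_cyclic => //.
    by rewrite (_ : word _ _ _ = iota) //; apply/funext.
move=> H' pi' Omega' V' hpi' hV' [Z' [Zi' [_ V0' cyc' map' st']]].
have ig' s t : inner (word pi' Omega' V' s) (word pi' Omega' V' t) =
    correlation Phi phi 1 s t.
  by rewrite -(inner_word hpi' hV' V0' map') // repr_one.
have [|W [Wu WE]] := gram_unitary it (word_total hpi' hV' V0' map' cyc').
  by move=> s t; rewrite ig' ig.
have Wb : bounded_operator W by case: Wu.
exists W; split=> //.
- move=> a; apply: (total_bounded_eq it).
  + exact: bounded_comp Wb (repr_bounded hpi a).
  + exact: bounded_comp (repr_bounded hpi' a) Wb.
  + by move=> s /=; rewrite WE -hword word_mul_head // hword WE word_mul_head.
- exact: WE.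
- apply: (total_bounded_eq it).
  + exact: bounded_comp Wb Vb.
  + exact: bounded_comp (isometry_bounded hV') Wb.
  + by move=> s /=; rewrite WE -hword word_shift // hword WE word_shift.
Qed.
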